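(* Let $V$ be a finite-dimensional complex vector space and let $f\in\operatorname{Sym}^d V$ be nonzero. Then \[ \mathrm{cR}^{\otimes}_d(f)\ \leq\ \underline{\mathrm{cR}}_d(f), \] where $\mathrm{cR}^{\otimes}_d(f)$ is the tensor asymptotic cactus rank of $f$ and $\underline{\mathrm{cR}}_d(f)$ is its border cactus rank.
   Context: For vector spaces $V_1,\dots,V_k$ over $\mathbb{C}$ and $\mathbf d=(d_1,\dots,d_k)$, let $\nu_{\mathbf d}:\mathbb{P}V_1\times\cdots\times\mathbb{P}V_k\to\mathbb{P}(\operatorname{Sym}^{d_1}V_1\otimes\cdots\otimes\operatorname{Sym}^{d_k}V_k)$, $([\ell_1],\dots,[\ell_k])\mapsto[\ell_1^{d_1}\otimes\cdots\otimes\ell_k^{d_k}]$ be the Segre-Veronese embedding. The cactus rank $\mathrm{cR}_{\mathbf d}(t)$ of $t\in\operatorname{Sym}^{d_1}V_1\otimes\cdots\otimes\operatorname{Sym}^{d_k}V_k$ is the minimal $r$ such that there is a $0$-dimensional scheme $S\subset\mathbb{P}V_1\times\cdots\times\mathbb{P}V_k$ of length $r$ with $[t]\in\langle\nu_{\mathbf d}(S)\rangle$ (linear span of the scheme). For $k=1$ this is the cactus rank $\mathrm{cR}_d(f)$ of a form $f\in\operatorname{Sym}^dV$. The border cactus rank $\underline{\mathrm{cR}}_d(f)$ is the minimal $r$ such that there is a family $(f_\varepsilon)_{\varepsilon>0}\subset\operatorname{Sym}^dV$ with $f=\lim_{\varepsilon\to0}f_\varepsilon$ and $\mathrm{cR}_d(f_\varepsilon)=r$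 for all $\varepsilon$. The tensor asymptotic cactus rank is $\mathrm{cR}^{\otimes}_d(f)=\lim_{k\to\infty}\left[\mathrm{cR}_{\mathbf d}(f^{\otimes k})\right]^{1/k}$, where $f^{\otimes k}\in(\operatorname{Sym}^dV)^{\otimes k}$ and $\mathbf d=(d,\dots,d)$ ($k$ entries). The limit exists by Fekete's Lemma, since cactus rank is submultiplicative under tensor product: $\mathrm{cR}_{\mathbf d|\mathbf e}(t\otimes s)\le\mathrm{cR}_{\mathbf d}(t)\,\mathrm{cR}_{\mathbf e}(s)$, with $\mathbf d|\mathbf e$ the concatenation. *)

(* Defs.v *)
From HB Require Import structures.
From mathcomp Require Import all_boot all_order all_algebra.
(* mpoly has to be imported before MathComp-Analysis: in the other order the
   levels of their notations conflict. *)
From mathcomp Require Import complex mpoly.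
From mathcomp Require Import boolp classical_sets reals topology normedtype.
From mathcomp Require Import sequences exp.

Set Implicit Arguments.
Unset Strict Implicit.
Unset Printing Implicit Defensive.

Import Order.TTheory GRing.Theory Num.Theory.
Import numFieldNormedType.Exports.

Local Open Scope classical_set_scope.
Local Open Scope ring_scope.

(* 0 if A is empty *)
Definition least (A : set nat) : nat :=
  xget 0%N [set r | A r /\ forall s, A s -> (r <= s)%N].

(* The i-th factor is V_i = C^(n i) with its standard basis; the variable
   [mvar i j] stands for the j-th basis vector of V_i when a polynomial denotes
   an element of Sym V_1 (x) ... (x) Sym V_k, and for the j-th coordinate
   function on V_i when it denotes an element of the Cox ring of
   PV_1 x ... x PV_k. *)
Definition nvars (k : nat) (n : 'I_k -> nat) : nat :=
  #|{: {i : 'I_k & 'I_(n i)}}|.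

Definition mvar (k : nat) (n : 'I_k -> nat) (i : 'I_k) (j : 'I_(n i)) :
    'I_(nvars n) :=
  enum_rank (Tagged (fun i => 'I_(n i)) j).

Section MultiProjective.
Context (C : numClosedFieldType) (k : nat) (n : 'I_k -> nat).

Local Notation P := {mpoly C[nvars n]}.

Definition multideg (m : 'X_{1..nvars n}) (i : 'I_k) : nat :=
  (\sum_(j < n i) m (mvar j))%N.

(* For D = d, these are the elements of Sym^(d_1) V_1 (x) ... (x) Sym^(d_k) V_k
   (resp. the forms of multidegree D). *)
Definition multihomog (D : 'I_k -> nat) (F : P) : Prop :=
  forall m, m \in msupp F -> forall i, multideg m i = D i.

Definition mhcomp (D : 'I_k -> nat) (F : P) : P :=
  \sum_(m <- msupp F | [forall i, multideg m i == D i]) F@_m *: 'X_[m].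

(* Closed subschemes of PV_1 x ... x PV_k correspond bijectively to the
   multihomogeneous ideals of the Cox ring that are saturated with respect to
   the irrelevant ideal B = \bigcap_i (x_(i,j))_j; B is generated by the products
   of one variable from each factor, and saturation is (I : B) = I. *)
Record subscheme_ideal (I : set P) : Prop := SubschemeIdeal {
  subscheme_ideal0 : I 0;
  subscheme_idealD : forall F G, I F -> I G -> I (F + G);
  subscheme_idealM : forall F G, I G -> I (F * G);
  subscheme_ideal_homog : forall F D, I F -> I (mhcomp D F);
  subscheme_ideal_sat : forall F,
    (forall c : (forall i : 'I_k, 'I_(n i)),
       I ((\prod_(i < k) 'X_(mvar (c i))) * F)) -> I F }.

(* dim (P / I)_D = r *)
Definition hilbert_value (I : set P) (D : 'I_k -> nat) (r : nat) : Prop :=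
  exists b : 'I_r -> P,
    (forall s, multihomog D (b s)) /\
    forall F, multihomog D F ->
      exists! c : 'rV[C]_r, I (F - \sum_(s < r) c 0 s *: b s).

(* dimension 0 (or empty) and length r: the multigraded Hilbert polynomial is
   the constant r *)
Definition zero_dim_of_length (I : set P) (r : nat) : Prop :=
  exists D0 : 'I_k -> nat, forall D : 'I_k -> nat,
    (forall i, (D0 i <= D i)%N) -> hilbert_value I D r.

(* l_1^(d_1) (x) ... (x) l_k^(d_k), where l_i is the vector of V_i with
   coordinates v (mvar i j) *)
Definition segre_veronese (d : 'I_k -> nat) (v : 'I_(nvars n) -> C) : P :=
  \prod_(i < k) (\sum_(j < n i) v (mvar j) *: 'X_(mvar j)) ^+ d i.

(* The linear span of nu_d(S) is the intersection of the hyperplanes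
   containing it; (lambda = 0) contains nu_d(S) iff the pullback G of lambda
   along nu_d, a form of multidegree d, is in the ideal of S. The functional
   lambda is defined on all of P, but only its values in multidegree d matter;
   those t that are not of multidegree d are never in the span. *)
Definition in_linear_span (d : 'I_k -> nat) (I : set P) (t : P) : Prop :=
  forall (lambda : {scalar P}) (G : P),
    (forall v, G.@[v] = lambda (segre_veronese d v)) -> I G -> lambda t = 0.

Definition cactus_rank (d : 'I_k -> nat) (t : P) : nat :=
  least [set r | exists I : set P,
    [/\ subscheme_ideal I, zero_dim_of_length I r & in_linear_span d I t]].

End MultiProjective.

Definition tensor_power (C : numClosedFieldType) (n k : nat)
    (f : {mpoly C[n]}) : {mpoly C[nvars (fun _ : 'I_k => n)]} :=
  \prod_(i < k)
    (f \mPo [tuple 'X_(mvar (n := fun _ : 'I_k => n) (i := i) j) | j < n]).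

Definition form_cactus_rank (C : numClosedFieldType) (n d : nat)
    (f : {mpoly C[n]}) : nat :=
  cactus_rank (fun _ : 'I_1 => d) (tensor_power 1 f).

Definition border_cactus_rank (R : realType) (n d : nat)
    (f : {mpoly R[i][n]}) : nat :=
  least [set r | exists f_ : R -> {mpoly R[i][n]},
    (forall e : R, 0 < e ->
       f_ e \is d.-homog /\ form_cactus_rank d (f_ e) = r) /\
    forall m : 'X_{1..n},
      ((f_ e)@_m : R[i]^o) @[e --> 0^'+] --> (f@_m : R[i]^o)].

Definition tensor_asymptotic_cactus_rank (R : realType) (n d : nat)
    (f : {mpoly R[i][n]}) : R :=
  limn (fun k : nat =>
    (cactus_rank (fun _ : 'I_k => d) (tensor_power k f))%:R `^ k%:R^-1).

(* Main.v *)
Require Import Defs.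
From HB Require Import structures.
From mathcomp Require Import all_boot all_order all_algebra.
From mathcomp Require Import complex ssrcomplements mpoly.
From mathcomp Require Import boolp classical_sets reals topology normedtype.
From mathcomp Require Import sequences exp lra.

(** Let [r] be the border cactus rank of [f] and [f_] a family of forms of
    cactus rank [r] with limit [f]. The limit is first removed by linear algebra.
    The coefficients of a tensor power [tensor_power k g] are the degree [k]
    monomials in the coefficients of [g], so that all these tensor powers lie in
    a space whose dimension is at most [k.+1 ^ N], where [N] depends only on the
    number of variables and the degree. The span of the [tensor_power k g], for
    [g] of cactus rank [r], is a linear subspace of it, hence closed, and it
    contains [tensor_power k f] as a limit: [tensor_power k f] is a combination
    of at most [k.+1 ^ N] powers [tensor_power k g] with [g] of cactus rank [r]
    ([limit_in_span]). As cactus rank is subadditive, and submultiplicative under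
    tensor products, the cactus rank of [tensor_power k f] is at most
    [k.+1 ^ N * r ^ k] ([cactus_rank_tensor_power_le]), and the polynomial factor
    disappears in the limit of the [k]-th roots ([limn_root_le]).

    Subadditivity and submultiplicativity are proved on functionals rather than
    on ideals. Let [S] be a scheme of length [r] in a projective space, and [y] a
    linear form that vanishes at no point of [S]. Setting [y] to 1 turns
    polynomials into functions on [S], that is, elements of an algebra of
    dimension [r]; a form in the span of [S] is, up to multinomial coefficients,
    the restriction to degree [d] of a functional [L] on this algebra, pulled
    back to the polynomials. Such an [L] has a Hankel matrix [L (m + m')] of rank
    at most [r], and is invariant under multiplication by [y]; this is
    [hankel_rep]. Products and sums of functionals with this property have it
    again, with ranks multiplied and added. Two lemmas relate this to schemes:
    [hankel_of_cactus_scheme] reads [L] off the ideal of [S], and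
    [cactus_scheme_of_hankel] recovers a scheme from several functionals, as the
    ideal of the multigraded forms that they annihilate.

    Both rest on [ex_regular_form]: if the Hilbert function of a saturated
    multigraded ideal is bounded, then in each factor some linear form is not a
    zero divisor modulo the ideal. Multiplication by these forms makes the
    Hilbert function nondecreasing, and a bounded nondecreasing function is
    eventually constant: this is how the dimension and the length of the
    constructed scheme are found ([zero_dim_of_bounded]). *)

Set Implicit Arguments.
Unset Strict Implicit.
Unset Printing Implicit Defensive.

Import Order.TTheory GRing.Theory Num.Theory.
Import numFieldNormedType.Exports.

Local Open Scope ring_scope.

(** * Least elements and functionals on polynomials *)

Lemma least_mem (A : set nat) r : A r -> A (least A).
Proof.
move=> Ar; have exA : exists s, `[< A s >] by exists r; apply/asboolP.
rewrite /least; case: xgetP => [s _ []|/(_ (ex_minn exA)) []] //.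
case: ex_minnP => s /asboolP As sP; split=> // u Au.
by apply: sP; apply/asboolP.
Qed.

Lemma least_le (A : set nat) r : A r -> (least A <= r)%N.
Proof.
move=> Ar; have exA : exists s, `[< A s >] by exists r; apply/asboolP.
rewrite /least; case: xgetP => [s _ [_]|/(_ (ex_minn exA)) []]; first exact.
case: ex_minnP => s /asboolP As sP; split=> // u Au.
by apply: sP; apply/asboolP.
Qed.

Lemma least_eq0 (A : set nat) : (forall r, A r -> r = 0%N) -> least A = 0%N.
Proof. by move=> A0; rewrite /least; case: xgetP => // r _ [/A0]. Qed.

Section SpanningScheme.
Context (C : numClosedFieldType) (k : nat) (n d : 'I_k -> nat).
Context (t : {mpoly C[nvars n]}).

Definition in_span_of_length (r : nat) := exists I : set {mpoly C[nvars n]},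
  [/\ subscheme_ideal I, zero_dim_of_length I r & in_linear_span d I t].

Lemma cactus_rank_span r :
  in_span_of_length r -> in_span_of_length (cactus_rank d t).
Proof. exact: (@least_mem in_span_of_length). Qed.

Lemma cactus_rank_le r : in_span_of_length r -> (cactus_rank d t <= r)%N.
Proof. exact: (@least_le in_span_of_length). Qed.

Lemma cactus_rank_eq0 :
  (forall r, in_span_of_length r -> r = 0%N) -> cactus_rank d t = 0%N.
Proof. exact: (@least_eq0 in_span_of_length). Qed.

End SpanningScheme.

Lemma ex_largest (P : nat -> Prop) B :
    P 0%N -> (forall r, P r -> (r <= B)%N) ->
  exists2 r, P r & ~ P r.+1.
Proof.
move=> P0 leB; have exP : exists r, `[< P r >] by exists 0%N; apply/asboolP.
have ubP r : `[< P r >] -> (r <= B)%N by move/asboolP/leB.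
case: (ex_maxnP exP ubP) => r /asboolP Pr rP; exists r => // PSr.
by have := rP r.+1; rewrite ltnn => /(_ (asboolT PSr)).
Qed.

Section LinearForms.
Context (K : fieldType) (N : nat).
Implicit Types (p q : {mpoly K[N]}) (w : 'X_{1..N} -> K).

Definition lform w p : K := \sum_(m <- msupp p) p@_m * w m.

Lemma lformwE w p b : (msize p <= b)%N ->
  lform w p = \sum_(m : 'X_{1..N < b}) p@_m * w m.
Proof.
move=> le_pb; pose I : subFinType _ := 'X_{1..N < b}.
rewrite /lform (big_mksub I) /=; first last.
- by move=> m /msize_mdeg_lt lt; apply: leq_trans lt le_pb.
- by rewrite msupp_uniq.
rewrite big_rmcond //= => m /memN_msupp_eq0 ->; rewrite mul0r //.
Qed.

Lemma lform_is_linear w : scalar (lform w).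
Proof.
move=> c p q; pose b := maxn (msize p) (msize q).
have lep : (msize p <= b)%N by rewrite leq_maxl.
have leq : (msize q <= b)%N by rewrite leq_maxr.
have lepq : (msize (c *: p + q) <= b)%N.
  apply: leq_trans (msizeD_le _ _) _; rewrite geq_max leq andbT.
  exact: leq_trans (msizeZ_le _ _) lep.
rewrite !(lformwE _ (b := b)) // mulr_sumr -big_split /=.
by apply: eq_bigr => m _; rewrite mcoeffD mcoeffZ mulrDl mulrA.
Qed.

HB.instance Definition _ w := GRing.isLinear.Build K {mpoly K[N]} K _ (lform w)
  (lform_is_linear w).

Lemma lformX w m : lform w 'X_[m] = w m.
Proof. by rewrite /lform msuppX big_seq1 mcoeffX eqxx mul1r. Qed.

Lemma scalar_lform (lambda : {scalar {mpoly K[N]}}) p :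
  lambda p = lform (fun m => lambda 'X_[m]) p.
Proof.
rewrite {1}[p]mpolyE linear_sum; apply: eq_bigr => m _.
by rewrite linearZ.
Qed.

Lemma eq_lform w1 w2 p : {in msupp p, w1 =1 w2} -> lform w1 p = lform w2 p.
Proof. by move=> eqw; apply: eq_big_seq => m /eqw ->. Qed.

Lemma lform_mulX w m p : lform w ('X_[m] * p) = lform (fun u => w (m + u)%MM) p.
Proof.
rewrite {1}[p]mpolyE mulr_sumr linear_sum; apply: eq_bigr => u _.
by rewrite -scalerAr linearZ /= -mpolyXD lformX.
Qed.

End LinearForms.

(** * Multigraded forms and regular linear forms *)

Section Multigrading.
Context (C : numClosedFieldType) (k : nat) (n : 'I_k -> nat).
Local Notation P := {mpoly C[nvars n]}.
Implicit Types (F G : P) (D E : 'I_k -> nat) (m : 'X_{1..nvars n}).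

Lemma mvar_eq (i i' : 'I_k) (j : 'I_(n i)) (j' : 'I_(n i')) :
  (mvar j == mvar j') = (Tagged (fun i => 'I_(n i)) j == Tagged _ j').
Proof. by rewrite /mvar (inj_eq enum_rank_inj). Qed.

Lemma multidegD m m' i : multideg (m + m') i = (multideg m i + multideg m' i)%N.
Proof. by rewrite /multideg -big_split; apply: eq_bigr => j _; rewrite mnmDE. Qed.

Lemma multideg_mvar (i i' : 'I_k) (j : 'I_(n i)) :
  multideg U_(mvar j) i' = (i == i').
Proof.
rewrite /multideg; have [<-|neq] := eqVneq i i'; last first.
  rewrite big1 // => j' _; rewrite mnm1E mvar_eq -tag_eqE /tag_eq /=.
  by rewrite (negPf neq).
rewrite (bigD1 j) //= mnm1E eqxx big1 // => j' neq.
by rewrite mnm1E mvar_eq eq_Tagged /= eq_sym (negPf neq).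
Qed.

Lemma eq_multihomog D E F : multihomog D F -> D =1 E -> multihomog E F.
Proof. by move=> hF eqDE m /hF hm i; rewrite hm. Qed.

Lemma multihomogP D F :
  (forall m, ~ (forall i, multideg m i = D i) -> F@_m = 0) -> multihomog D F.
Proof.
move=> h m; rewrite mcoeff_msupp => nz i; apply/eqP; apply: contraNT nz => ne.
by apply/eqP/h => /(_ i) e; rewrite e eqxx in ne.
Qed.

Lemma multihomog_coeff D F m :
  multihomog D F -> ~ (forall i, multideg m i = D i) -> F@_m = 0.
Proof. by move=> hF hm; apply: memN_msupp_eq0; apply/negP => /hF. Qed.

Lemma multihomogX m : multihomog (multideg m) ('X_[m] : P).
Proof. by move=> u; rewrite msuppX inE => /eqP ->. Qed.

Lemma multihomog0 D : multihomog D (0 : P).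
Proof. by move=> m; rewrite msupp0. Qed.

Lemma multihomog1 : multihomog (fun=> 0%N) (1 : P).
Proof.
by move=> m; rewrite msupp1 inE => /eqP -> i; rewrite /multideg big1 // => j _; rewrite mnm0E.
Qed.

Lemma multihomogD D F G : multihomog D F -> multihomog D G -> multihomog D (F + G).
Proof.
by move=> hF hG m /msuppD_le; rewrite mem_cat => /orP[/hF|/hG].
Qed.

Lemma multihomogZ D c F : multihomog D F -> multihomog D (c *: F).
Proof. by move=> hF m /msuppZ_le /hF. Qed.

Lemma multihomog_sum D (J : Type) (s : seq J) (Q : pred J) (F : J -> P) :
  (forall j, Q j -> multihomog D (F j)) -> multihomog D (\sum_(j <- s | Q j) F j).
Proof.
move=> hF; elim/big_ind: _ => //; [exact: multihomog0|exact: multihomogD].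
Qed.

Lemma multihomogM D E F G :
  multihomog D F -> multihomog E G -> multihomog (fun i => D i + E i)%N (F * G).
Proof.
move=> hF hG m /msuppM_le /allpairsP[[u v] /= [/hF hu /hG hv ->]] i.
by rewrite multidegD hu hv.
Qed.

Lemma multihomogXn D F a :
  multihomog D F -> multihomog (fun i => D i * a)%N (F ^+ a).
Proof.
move=> hF; elim: a => [|a IH].
  by rewrite expr0; apply: (eq_multihomog multihomog1) => i; rewrite muln0.
rewrite exprS; apply: (eq_multihomog (multihomogM hF IH)) => i.
by rewrite mulnS.
Qed.

Definition linear_form i (y : 'I_(n i) -> C) : P := \sum_j y j *: 'X_(mvar j).

Lemma multihomog_linear_form i (y : 'I_(n i) -> C) :
  multihomog (fun i' => (i == i') : nat) (linear_form y).
Proof.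
apply: multihomog_sum => j _; apply: multihomogZ.
by apply: (eq_multihomog (@multihomogX U_(mvar j))) => i'; rewrite multideg_mvar.
Qed.

Lemma mcoeff_mhcomp D F m :
  (mhcomp D F)@_m = if [forall i, multideg m i == D i] then F@_m else 0.
Proof.
rewrite /mhcomp raddf_sum /=.
under eq_bigr do rewrite mcoeffZ mcoeffX.
have [mF|mF] := boolP (m \in msupp F); last first.
  rewrite big1_seq; first by rewrite (memN_msupp_eq0 mF) if_same.
  move=> u /andP[_ uF]; case: eqP => [eum|]; last by rewrite mulr0.
  by rewrite -eum uF in mF.
rewrite big_mkcond (bigD1_seq m) //= eqxx mulr1 big1 ?addr0 //.
by move=> u /negPf neq; rewrite neq mulr0 if_same.
Qed.

End Multigrading.

Section NonZeroDivisor.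
Context (C : numClosedFieldType) (k : nat) (n : 'I_k -> nat).
Local Notation P := {mpoly C[nvars n]}.
Context (I : set P) (idI : subscheme_ideal I).
Implicit Types (F G : P) (D E : 'I_k -> nat).

Lemma idealM F G : I G -> I (F * G).
Proof. exact: subscheme_idealM. Qed.

Lemma idealZ c F : I F -> I (c *: F).
Proof. by rewrite -mul_mpolyC; exact: idealM. Qed.

Lemma idealD F G : I F -> I G -> I (F + G).
Proof. exact: subscheme_idealD. Qed.

Lemma idealB F G : I F -> I G -> I (F - G).
Proof. by move=> IF IG; apply: idealD => //; rewrite -scaleN1r; apply: idealZ. Qed.

Lemma ideal_sum (J : Type) (s : seq J) (Q : pred J) (F : J -> P) :
  (forall j, Q j -> I (F j)) -> I (\sum_(j <- s | Q j) F j).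
Proof.
move=> hF; elim/big_ind: _ => //; [exact: subscheme_ideal0|exact: idealD].
Qed.

Lemma ideal_sat1 (i : 'I_k) F :
  (forall j : 'I_(n i), I ('X_(mvar j) * F)) -> I F.
Proof.
move=> hF; apply: (subscheme_ideal_sat idI) => c.
by rewrite (bigD1 i) //= mulrAC; rewrite mulrC; apply: idealM.
Qed.

(** Geometrically, [y] vanishes at all points of the scheme of [I] at which [F]
    is not locally in [I]. The condition is stable under sums in [y], so that
    the [y] in a given factor form a subspace. *)
Definition nilp_on (y F : P) := exists a, I (y ^+ a * F).

Lemma nilp_onM y F G : nilp_on y F -> nilp_on y (G * F).
Proof. by move=> [a Ia]; exists a; rewrite mulrCA; apply: idealM. Qed.

Lemma nilp_onD y z F : nilp_on y F -> nilp_on z F -> nilp_on (y + z) F.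
Proof.
move=> [a Ia] [b Ib]; exists (a + b)%N; rewrite exprDn mulr_suml.
apply: ideal_sum => i _; rewrite -scaler_nat -scalerAl; apply: idealZ.
have [le_bi|lt_ib] := leqP b i.
  by rewrite -mulrA -(subnK le_bi) exprD -mulrA; do 2!apply: idealM.
have le_a : (a <= a + b - i)%N by rewrite -addnBA ?leq_addr // ltnW.
by rewrite mulrAC mulrC -(subnK le_a) exprD -mulrA; do 2!apply: idealM.
Qed.

Lemma nilp_onZ c y F : nilp_on y F -> nilp_on (c *: y) F.
Proof. by move=> [a Ia]; exists a; rewrite exprZn -scalerAl; apply: idealZ. Qed.

Lemma nilp_on_sum (J : Type) (s : seq J) (y : J -> P) F :
  (forall j, nilp_on (y j) F) -> nilp_on (\sum_(j <- s) y j) F.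
Proof.
move=> hy; elim/big_ind: _ => //; last by move=> *; apply: nilp_onD.
by exists 1%N; rewrite mul0r; apply: subscheme_ideal0.
Qed.

(** If [F] is not in [I], one can multiply [F] by the largest power of each
    variable of the factor that does not bring it into [I]; the result is
    outside [I] but is brought into [I] by every variable of the factor, which
    contradicts saturation. *)
Lemma nilp_on_vars (i : 'I_k) F :
  (forall j : 'I_(n i), nilp_on 'X_(mvar j) F) -> I F.
Proof.
move=> nilF; apply/notP => nIF.
have [g nIg Ig] : exists2 g, ~ I (g * F) &
    forall j : 'I_(n i), j \in enum 'I_(n i) -> I ('X_(mvar j) * (g * F)).
  elim: (enum _) => [|j s [g nIg Ig]]; first by exists 1; rewrite ?mul1r.
  have exa : exists a, `[< I ('X_(mvar j) ^+ a * (g * F)) >].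
    by have [a Ia] := nilp_onM g (nilF j); exists a; apply/asboolP.
  case: (ex_minnP exa) => -[|a] /asboolP Ia amin.
    by case: nIg; rewrite expr0 mul1r in Ia.
  exists ('X_(mvar j) ^+ a * g) => [Ia'|j'].
    by have := amin a; rewrite ltnn mulrA => /(_ (asboolT Ia')).
  rewrite inE => /orP[/eqP ->|js]; first by rewrite mulrA mulrA -exprS -mulrA.
  by rewrite -mulrA mulrCA; apply: idealM; apply: Ig.
by apply: nIg; apply: (@ideal_sat1 i) => j; apply: Ig; rewrite mem_enum.
Qed.

(** Points of the moment curve: any [n i] of them form a basis of the linear
    forms in factor [i], so that a proper subspace contains fewer than [n i]. *)
Definition moment_form (i : 'I_k) (s : nat) : P :=
  linear_form (fun j : 'I_(n i) => s%:R ^+ j).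

(** By inversion of a Vandermonde matrix, the variables are combinations of the
    given moment forms, and are therefore nilpotent on [F] as well. *)
Lemma nilp_on_moment (i : 'I_k) F (f : 'I_(n i) -> nat) :
  injective f -> (forall a, nilp_on (moment_form i (f a)) F) -> I F.
Proof.
move=> injf nilF; pose v : 'rV[C]_(n i) := \row_a (f a)%:R.
pose V := (Vandermonde (n i) v)^T; have uV : V \in unitmx.
  rewrite unitmx_tr unitmxE det_Vandermonde unitfE.
  apply/prodf_neq0 => a _; apply/prodf_neq0 => b ltab.
  rewrite !mxE subr_eq0 eqr_nat (inj_eq injf).
  by apply: contraTneq ltab => ->; rewrite ltnn.
apply: (@nilp_on_vars i) => j.
suff -> : 'X_(mvar j) = \sum_a (invmx V) j a *: moment_form i (f a) :> P.
  by apply: nilp_on_sum => a; apply: nilp_onZ.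
under eq_bigr do rewrite /moment_form /linear_form scaler_sumr.
rewrite exchange_big /=.
transitivity (\sum_l ((invmx V) *m V) j l *: ('X_(mvar l) : P)).
  rewrite mulVmx // (bigD1 j) //= mxE eqxx scale1r big1 ?addr0 // => l neq.
  by rewrite mxE eq_sym (negPf neq) scale0r.
apply: eq_bigr => l _; rewrite mxE scaler_suml.
by apply: eq_bigr => a _; rewrite scalerA !mxE.
Qed.

Section Primary.
Context (i : 'I_k) (T : nat).

(** A finite substitute for the associated primes of [I]: among [T] candidate
    linear forms, those that are nilpotent on [F]. *)
Definition nil_forms F : {set 'I_T} :=
  [set s : 'I_T | `[< nilp_on (moment_form i s) F >]].

Lemma nil_formsP F (s : 'I_T) :
  reflect (nilp_on (moment_form i s) F) (s \in nil_forms F).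
Proof. by rewrite inE; apply: asboolP. Qed.

Lemma nil_formsM F G : nil_forms F \subset nil_forms (G * F).
Proof. by apply/fintype.subsetP => s /nil_formsP ?; apply/nil_formsP/nilp_onM. Qed.

Lemma nil_forms_proper F : ~ I F -> (#|nil_forms F| < n i)%N.
Proof.
move=> nIF; rewrite ltnNge; apply/negP => le_n; apply: nIF.
pose f (a : 'I_(n i)) : 'I_T := enum_val (widen_ord le_n a).
apply: (@nilp_on_moment i _ (fun a => val (f a))) => [a b /val_inj|a].
  by move=> /enum_val_inj [] /val_inj.
exact/nil_formsP/enum_valP.
Qed.

(** The multiples of [F] modulo [I] all have the same set of nilpotent forms, as
    if they had a single associated prime. *)
Definition primary_elt F := ~ I F /\
  forall D G, multihomog D G -> ~ I (G * F) -> nil_forms (G * F) = nil_forms F.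

Lemma primary_eltM D F G : primary_elt F -> multihomog D G -> ~ I (G * F) ->
  primary_elt (G * F) /\ nil_forms (G * F) = nil_forms F.
Proof.
move=> [nIF primF] hG nIGF; have eqGF := primF _ _ hG nIGF.
split=> //; split=> // E H hH; rewrite mulrA => nIHGF.
by rewrite (primF _ _ (multihomogM hH hG)) // eqGF.
Qed.

(** Multiplication can only enlarge [nil_forms F], which has at most [T]
    elements; take a multiple for which it is as large as possible. *)
Lemma ex_primary_elt F : ~ I F ->
  exists D G, [/\ multihomog D G, primary_elt (G * F)
                & nil_forms F \subset nil_forms (G * F)].
Proof.
move=> nIF.
pose Q t := exists D G, [/\ multihomog D G, ~ I (G * F)
                          & (t <= #|nil_forms (G * F)|)%N].
have Q0 : Q 0%N by exists (fun=> 0%N), 1; split=> //; [exact: multihomog1|rewrite mul1r].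
have leQ t : Q t -> (t <= T)%N.
  by move=> [D [G [_ _ le_t]]]; rewrite (leq_trans le_t) // -[leqRHS]card_ord max_card.
have [t [D [G [hG nIG le_t]]] nQ] := ex_largest Q0 leQ.
exists D, G; split; [by []| |exact: nil_formsM].
split=> // E H hH nIH; apply/eqP; rewrite eq_sym eqEcard nil_formsM /=.
rewrite leqNgt; apply/negP => lt; apply: nQ.
exists (fun i => E i + D i)%N, (H * G); rewrite -mulrA.
by split=> //; [exact: multihomogM|apply: leq_ltn_trans lt].
Qed.

(** This is the linear independence of elements with distinct associated primes.
    Some form is nilpotent on one summand but not on another; a high power of
    it kills the summands of the first kind modulo [I] and leaves the others
    primary with the same [nil_forms], so the number of summands drops. *)
Lemma primary_sum (J : finType) (A : {set J}) (G : J -> P) :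
    A != finset.set0 -> (forall j, j \in A -> primary_elt (G j)) ->
    {in A &, injective (fun j => nil_forms (G j))} ->
  ~ I (\sum_(j in A) G j).
Proof.
have [t] := ubnP #|A|; elim: t => // t IH in A G * => ltA A0 primG injG IsG.
have /set0Pn[j1 j1A] := A0.
have [eqA|neA] := eqVneq A [set j1]%SET.
  by move: IsG; rewrite eqA big_set1; have [] := primG _ j1A.
have [j2 j2A neq12] : exists2 j2, j2 \in A & j1 != j2.
  have : ~~ (A \subset [set j1]%SET).
    apply: contraNN neA => sA; rewrite finset.eqEsubset sA /=.
    by rewrite finset.sub1set.
  by case/fintype.subsetPn => j2 j2A; rewrite inE eq_sym; exists j2.
have [s sP] : exists s, (s \in nil_forms (G j1)) != (s \in nil_forms (G j2)).
  apply/existsP; apply: contraNT neq12 => /existsPn h.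
  by apply/eqP/injG => //; apply/setP => s; apply/eqP; rewrite -[_ == _]negbK h.
pose y := moment_form i s; pose A' := [set j in A | s \notin nil_forms (G j)]%SET.
have [a Ia] : exists a, forall j, j \in A -> s \in nil_forms (G j) ->
    I (y ^+ a * G j).
  have /choice[a Ia] : forall j, exists a, s \in nil_forms (G j) -> I (y ^+ a * G j).
    move=> j; have [/nil_formsP [a Ia]|] := boolP (s \in _); first by exists a.
    by exists 0%N.
  exists (\max_j a j)%N => j _ /Ia; rewrite -(subnK (leq_bigmax j)) exprD -mulrA.
  exact: idealM.
have [Dy hya] : exists D, multihomog D (y ^+ a).
  by eexists; apply: multihomogXn; apply: multihomog_linear_form.
have G'P j : j \in A' -> primary_elt (y ^+ a * G j) /\
    nil_forms (y ^+ a * G j) = nil_forms (G j).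
  rewrite inE => /andP[jA /nil_formsP nil]; apply: (primary_eltM (primG _ jA) hya).
  by move=> h; apply: nil; exists a.
apply: (IH A' (fun j => y ^+ a * G j)).
- move: ltA; rewrite ltnS; apply: leq_trans.
  apply: proper_card; apply/fintype.properP; split.
    by apply/fintype.subsetP => j; rewrite inE => /andP[].
  move: sP; case h1: (s \in nil_forms (G j1)); case h2: (s \in nil_forms (G j2)) => // _.
    by exists j1 => //; rewrite inE j1A h1.
  by exists j2 => //; rewrite inE j2A h2.
- apply/set0Pn; move: sP.
  case h1: (s \in nil_forms (G j1)); case h2: (s \in nil_forms (G j2)) => // _.
    by exists j2; rewrite inE j2A h2.
  by exists j1; rewrite inE j1A h1.
- by move=> j /G'P[].
- move=> j j' jA' j'A'; rewrite (G'P _ jA').2 (G'P _ j'A').2.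
  by move: jA' j'A'; rewrite !inE => /andP[jA _] /andP[j'A _]; apply: injG.
suff -> : \sum_(j in A') y ^+ a * G j = y ^+ a * (\sum_(j in A) G j) -
    \sum_(j in A | s \in nil_forms (G j)) y ^+ a * G j.
  apply: idealB; first exact: idealM.
  by apply: ideal_sum => j /andP[jA sj]; apply: Ia.
rewrite mulr_sumr [X in _ = X - _](bigID (fun j => s \in nil_forms (G j))) /=.
by rewrite [X in X - _]addrC addrK; apply: eq_bigl => j; rewrite inE.
Qed.
End Primary.

(** By saturation, an element outside [I] has multiples outside [I] in every
    larger multidegree. *)
Lemma ideal_raise (i : 'I_k) D F a : multihomog D F -> ~ I F -> exists G,
  [/\ multihomog (fun i' => (i == i') * a)%N G & ~ I (G * F)].
Proof.
move=> hF nIF; elim: a => [|a [G [hG nIG]]].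
  exists 1; rewrite mul1r; split=> //.
  by apply: (eq_multihomog (@multihomog1 _ _ _)) => i'; rewrite muln0.
have [j nIj] : exists j : 'I_(n i), ~ I ('X_(mvar j) * (G * F)).
  by apply: contra_notP nIG => /forallNP h; apply: (@ideal_sat1 i) => j; apply/notP/h.
exists ('X_(mvar j) * G); rewrite -mulrA; split=> //.
apply: (eq_multihomog (multihomogM (@multihomogX _ _ _ U_(mvar j)) hG)) => i'.
by rewrite multideg_mvar mulnS.
Qed.

Lemma ideal_raise_to D E F : (forall i, D i <= E i)%N -> multihomog D F -> ~ I F ->
  exists G D', [/\ multihomog D' G, multihomog E (G * F) & ~ I (G * F)].
Proof.
move=> leDE hF nIF.
suff [G [hG nIG]] : exists G,
   multihomog (fun i => if i \in enum 'I_k then E i - D i else 0)%N G /\ ~ I (G * F).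
  exists G, (fun i => if i \in enum 'I_k then E i - D i else 0)%N; split=> //.
  apply: (eq_multihomog (multihomogM hG hF)) => i.
  by rewrite mem_enum inE subnK.
elim: (enum _) (enum_uniq 'I_k) => [|i s IH] /=.
  by exists 1; rewrite mul1r; split=> //; exact: multihomog1.
case/andP=> i_s /IH[G [hG nIG]].
have [H [hH nIH]] := ideal_raise i (E i - D i) (multihomogM hG hF) nIG.
exists (H * G); rewrite -mulrA; split=> //.
apply: (eq_multihomog (multihomogM hH hG)) => i' /=.
rewrite inE eq_sym; have [->|] //= := eqVneq i' i.
by rewrite (negPf i_s) mul1n addn0.
Qed.

Definition indep_family D r (b : 'I_r -> P) :=
  (forall s, multihomog D (b s)) /\
  forall c : 'rV[C]_r, I (\sum_(s < r) c 0 s *: b s) -> c = 0.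

(** If each of [T] moment forms were a zero divisor modulo [I], each would belong
    to [nil_forms F] for some primary [F], and all these [F] can be brought to
    a common multidegree. Each of the sets [nil_forms F] has fewer than [n i]
    elements, so that with [T > B * n i] there are more than [B] distinct ones;
    they give more than [B] independent elements by [primary_sum]. *)
Lemma ex_regular_form (D0 : 'I_k -> nat) B (i : 'I_k) :
    (forall D, (forall i, D0 i <= D i)%N ->
       forall r (b : 'I_r -> P), indep_family D b -> (r <= B)%N) ->
  exists y : 'I_(n i) -> C, forall D F, multihomog D F ->
    I (linear_form y * F) -> I F.
Proof.
move=> bnd; pose T := (B * n i).+1.
suff [s hs] : exists s : 'I_T, forall D F, multihomog D F ->
    I (moment_form i s * F) -> I F by exists (fun j => s%:R ^+ j).
apply/not_existsP => h.
have /choice[DF DFP] : forall s : 'I_T, exists DF : ('I_k -> nat) * P,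
    [/\ multihomog DF.1 DF.2, primary_elt i T DF.2 & s \in nil_forms i T DF.2].
  move=> s; have /existsNP[D /existsNP[F /not_implyP[hF /not_implyP[IsF nIF]]]] := h s.
  have [E [G [hG primGF sub]]] := ex_primary_elt i T nIF.
  exists ((fun i => E i + D i)%N, G * F); split=> //=; first exact: multihomogM.
  by apply: (fintype.subsetP sub); apply/nil_formsP; exists 1%N; rewrite expr1.
pose E i := (D0 i + \sum_(s : 'I_T) (DF s).1 i)%N.
have leDE s i' : ((DF s).1 i' <= E i')%N.
  by rewrite /E (bigD1 s) //= addnCA leq_addr.
have /choice[F FP] : forall s : 'I_T, exists F,
    [/\ multihomog E F, primary_elt i T F & s \in nil_forms i T F].
  move=> s; have [hF primF sF] := DFP s; have [nIF _] := primF.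
  have [G [D' [hG hGF nIGF]]] := ideal_raise_to (leDE s) hF nIF.
  have [primGF eqnil] := primary_eltM primF hG nIGF.
  by exists (G * (DF s).2); rewrite eqnil.
pose ZZ : {set {set 'I_T}} := [set nil_forms i T (F s) | s : 'I_T]%SET.
have /choice[rep repP] : forall a : 'I_#|ZZ|, exists s, enum_val a = nil_forms i T (F s).
  by move=> a; have /imsetP[s _ ->] := enum_valP a; exists s.
(* one representative for each value of nil_forms *)
have indF : indep_family E (fun a => F (rep a)).
  split=> [a|c Ic]; first by have [] := FP (rep a).
  apply/rowP => a; rewrite mxE; apply/eqP; apply/negP => /negP ca.
  pose A := [set a | c 0 a != 0]%SET.
  have nilZ a' : a' \in A -> primary_elt i T (c 0 a' *: F (rep a')) /\
      nil_forms i T (c 0 a' *: F (rep a')) = nil_forms i T (F (rep a')).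
    rewrite inE => nz; have [_ primF _] := FP (rep a'); have [nIF _] := primF.
    rewrite -mul_mpolyC; apply: primary_eltM primF _ _.
      by rewrite -alg_mpolyC; apply: multihomogZ; exact: multihomog1.
    rewrite mul_mpolyC => /(idealZ (c 0 a')^-1).
    by rewrite scalerA mulVf // scale1r.
  apply: (@primary_sum i T _ A (fun a => c 0 a *: F (rep a))).
  - by apply/set0Pn; exists a; rewrite inE.
  - by move=> a' /nilZ[].
  - move=> a1 a2 a1A a2A; rewrite (nilZ _ a1A).2 (nilZ _ a2A).2.
    by rewrite -!repP => /enum_val_inj.
  rewrite (_ : \sum_(_ in _) _ = \sum_a c 0 a *: F (rep a)) //.
  rewrite big_mkcond; apply: eq_bigr => a' _; rewrite inE.
  by case: eqP => // ->; rewrite scale0r.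
have := bnd E (fun i => leq_addr _ _) _ _ indF.
rewrite leqNgt => /negP; apply.
have : (T <= #|ZZ| * n i)%N.
  rewrite -sum_nat_const -[leqLHS]card_ord -sum1_card.
  rewrite (partition_big (fun s => nil_forms i T (F s)) (mem ZZ)) /=; last first.
    by move=> s _; apply: imset_f.
  apply: leq_sum => Z /imsetP[s _ eqZ].
  rewrite sum1_card; have [_ [nIF _] _] := FP s.
  apply: leq_trans (ltnW (nil_forms_proper i T nIF)); rewrite -eqZ.
  apply: subset_leq_card; apply/fintype.subsetP => s' es'.
  have <- : nil_forms i T (F s') = Z by apply/eqP.
  by have [] := FP s'.
by rewrite ltn_mul2r => /andP[].
Qed.

End NonZeroDivisor.

(** * Hilbert functions *)

Section HilbertFunction.
Context (C : numClosedFieldType) (k : nat) (n : 'I_k -> nat).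
Local Notation P := {mpoly C[nvars n]}.
Context (I : set P) (idI : subscheme_ideal I).
Implicit Types (F G : P) (D E : 'I_k -> nat).

Lemma multihomog_prod (J : Type) (s : seq J) (D : J -> 'I_k -> nat) (F : J -> P) :
    (forall j, multihomog (D j) (F j)) ->
  multihomog (fun i => \sum_(j <- s) D j i)%N (\prod_(j <- s) F j).
Proof.
move=> hF; elim: s => [|j s IH].
  by rewrite big_nil; apply: (eq_multihomog (@multihomog1 _ _ _)) => i; rewrite big_nil.
rewrite big_cons; apply: (eq_multihomog (multihomogM (hF j) IH)) => i.
by rewrite big_cons.
Qed.

Lemma indep_family_spans D r (b : 'I_r -> P) F : indep_family I D b ->
    (forall b' : 'I_r.+1 -> P, ~ indep_family I D b') -> multihomog D F ->
  exists! c : 'rV[C]_r, I (F - \sum_(s < r) c 0 s *: b s).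
Proof.
move=> [hb indb] nb hF.
have uniq (c c' : 'rV_r) : I (F - \sum_(s < r) c 0 s *: b s) ->
    I (F - \sum_(s < r) c' 0 s *: b s) -> c = c'.
  move=> Ic Ic'; apply/esym/eqP; rewrite -subr_eq0; apply/eqP/indb.
  move: (idealB idI Ic Ic'); rewrite opprB addrC addrA subrK -sumrB.
  by congr (I _); apply: eq_bigr => s _; rewrite !mxE scalerBl.
pose b' (s : 'I_r.+1) := oapp b F (unlift ord0 s).
have [c [Ic nzc]] : exists c : 'rV_r.+1, I (\sum_s c 0 s *: b' s) /\ c <> 0.
  have hb' s : multihomog D (b' s) by rewrite /b'; case: unliftP => [j|] _ //=.
  have := nb b'; rewrite /indep_family => /not_andP[//|/existsNP[c /not_implyP[Ic nc]]].
  by exists c.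
have sumE : \sum_s c 0 s *: b' s = c 0 ord0 *: F + \sum_(s < r) c 0 (lift ord0 s) *: b s.
  rewrite big_ord_recl /b' unlift_none; congr (_ + _).
  by apply: eq_bigr => s _; rewrite liftK.
have c0 : c 0 ord0 != 0.
  apply/eqP => c0; apply: nzc; move: Ic; rewrite sumE c0 scale0r add0r => Ic.
  have /rowP h : \row_s c 0 (lift ord0 s) = 0.
    by apply: indb; under eq_bigr do rewrite mxE.
  apply/rowP => s; rewrite mxE; case: (unliftP ord0 s) => [j ->|-> //].
  by have := h j; rewrite !mxE.
pose c' : 'rV_r := \row_s (- (c 0 ord0)^-1 * c 0 (lift ord0 s)).
have Ic' : I (F - \sum_(s < r) c' 0 s *: b s).
  move: (idealZ idI (c 0 ord0)^-1 Ic); rewrite sumE scalerDr scalerA mulVf // scale1r.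
  rewrite scaler_sumr -sumrN; congr (I (_ + _)); apply: eq_bigr => s _.
  by rewrite mxE mulNr scaleNr opprK scalerA.
by exists c'; split=> // c'' Ic''; apply: uniq Ic''.
Qed.

Lemma hilbert_of_indep D r (b : 'I_r -> P) : indep_family I D b ->
    (forall b' : 'I_r.+1 -> P, ~ indep_family I D b') ->
  hilbert_value I D r.
Proof.
move=> indb nb; exists b; split=> [|F hF]; first by have [] := indb.
exact: (indep_family_spans indb nb hF).
Qed.

Lemma hilbert_indep_le D r N (b : 'I_N -> P) :
  hilbert_value I D r -> indep_family I D b -> (N <= r)%N.
Proof.
move=> [e [he spane]] [hb indb].
have /choice[M IM] : forall s, exists c : 'rV[C]_r, I (b s - \sum_(t < r) c 0 t *: e t).
  by move=> s; have [c [Ic _]] := spane _ (hb s); exists c.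
suff /eqP <- : row_free (\matrix_s M s) by apply: rank_leq_col.
apply: inj_row_free => c cM; apply: indb.
have -> : \sum_s c 0 s *: b s = \sum_s c 0 s *: (b s - \sum_(t < r) M s 0 t *: e t).
  under [RHS]eq_bigr do rewrite scalerBr; rewrite sumrB.
  rewrite [X in _ - X](_ : _ = 0) ?subr0 //.
  under eq_bigr do rewrite scaler_sumr; rewrite exchange_big big1 //= => t _.
  under eq_bigr do rewrite scalerA; rewrite -scaler_suml.
  have /rowP/(_ t) := cM; rewrite !mxE; under eq_bigr do rewrite mxE.
  by move=> ->; rewrite scale0r.
by apply: ideal_sum => // s _; apply: idealZ.
Qed.

Definition regular_mod (G : P) := forall D F, multihomog D F -> I (G * F) -> I F.

Lemma ex_regular_of_degree :
    (forall i, exists y : 'I_(n i) -> C, regular_mod (linear_form y)) ->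
  forall e : 'I_k -> nat, exists2 G, multihomog e G & regular_mod G.
Proof.
move=> reg e.
pose good (G : P) := (exists D, multihomog D G) /\ regular_mod G.
have good1 : good 1.
  split; first by exists (fun=> 0%N); exact: multihomog1.
  by move=> D F _; rewrite mul1r.
have goodM G H : good G -> good H -> good (G * H).
  move=> [[D hG] regG] [[E hH] regH]; split.
    by eexists; apply: multihomogM hG hH.
  move=> D' F hF; rewrite -mulrA => /(regG _ _ (multihomogM hH hF)).
  exact: regH hF.
have /choice[G GP] : forall i, exists G : P,
    multihomog (fun i' => (i == i') * e i)%N G /\ good G.
  move=> i; have [y regy] := reg i; exists (linear_form y ^+ e i); split.
    exact/multihomogXn/multihomog_linear_form.
  elim: (e i) => [|a IH] //; rewrite exprS; apply: goodM => //.
  by split=> //; eexists; apply: multihomog_linear_form.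
exists (\prod_i G i).
  have := @multihomog_prod _ (index_enum 'I_k) _ G (fun i => (GP i).1).
  move/eq_multihomog; apply => i /=.
  rewrite (bigD1 i) //= eqxx mul1n big1 ?addn0 // => i' /negPf neq.
  by rewrite neq.
suff [] : good (\prod_i G i) by [].
by elim/big_ind: _ => // i _; have [] := GP i.
Qed.

(** Multiplication by regular forms carries independent families to independent
    families of every larger multidegree. From the multidegree of a largest
    independent family on, the Hilbert function is thus constant. *)
Lemma zero_dim_of_bounded B :
    (forall D r (b : 'I_r -> P), indep_family I D b -> (r <= B)%N) ->
  exists2 r, (r <= B)%N & zero_dim_of_length I r.
Proof.
move=> bnd.
pose Q r := exists D (b : 'I_r -> P), indep_family I D b.
have Q0 : Q 0%N.
  exists (fun=> 0%N), (fun=> 0); split=> [|c _]; first by case.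
  by apply/rowP => -[].
have leQ r : Q r -> (r <= B)%N by move=> [D [b /bnd]].
have [r [D0 [b [hb indb]]] nQ] := ex_largest Q0 leQ.
exists r; first exact: bnd (conj hb indb).
exists D0 => D leD.
have [G hG regG] := ex_regular_of_degree (fun i =>
  ex_regular_form (D0 := fun=> 0%N) idI i (fun D _ => bnd D)) (fun i => D i - D0 i)%N.
apply: (@hilbert_of_indep D r (fun s => G * b s)) => [|b' indb']; last first.
  by apply: nQ; exists D, b'.
split=> [s|c Ic].
  by apply: (eq_multihomog (multihomogM hG (hb s))) => i; rewrite subnK.
apply: indb; apply: (regG D0).
  by apply: multihomog_sum => s _; apply: multihomogZ.
rewrite mulr_sumr; congr (I _) : Ic; apply: eq_bigr => s _.
by rewrite scalerAr.
Qed.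

End HilbertFunction.

(** * Coefficients of tensor powers and of Veronese points *)

Section Evaluation.
Context (K : numDomainType).

Lemma base_expansion_inj (N b : nat) (u v : 'I_N -> nat) :
    (forall x, u x < b)%N -> (forall x, v x < b)%N ->
    (\sum_(x < N) u x * b ^ x = \sum_(x < N) v x * b ^ x)%N ->
  u =1 v.
Proof.
elim: N => [|N IH] in u v *; first by move=> _ _ _ [].
move=> ltu ltv; rewrite !big_ord_recl /= !expn0 !muln1.
have sumE (w : 'I_N.+1 -> nat) : (\sum_(x < N) w (lift ord0 x) * b ^ (bump 0 x) =
    (\sum_(x < N) w (lift ord0 x) * b ^ x) * b)%N.
  by rewrite big_distrl; apply: eq_bigr => x _ /=; rewrite -mulnA -expnSr.
rewrite !sumE => eqs.
have b0 : (0 < b)%N by apply: leq_ltn_trans (ltu ord0).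
have eq0 : u ord0 = v ord0.
  by move: (congr1 (modn^~ b) eqs); rewrite /= ![(_ + _ * b)%N]addnC !modnMDl !modn_small.
have eqS := IH (fun x => u (lift ord0 x)) (fun x => v (lift ord0 x)).
move: eqs; rewrite eq0 => /addnI/eqP; rewrite eqn_pmul2r // => /eqP eqs.
move=> x; case: (unliftP ord0 x) => [j ->|->] //.
exact: (eqS (fun j => ltu _) (fun j => ltv _) eqs j).
Qed.

(** Kronecker substitution: putting [t ^+ (b ^ x)] for the variable [x], with [b]
    above all exponents of [p], sends distinct monomials of [p] to distinct
    powers of [t], and reduces the claim to one variable. *)
Lemma meval_inj (N : nat) (p : {mpoly K[N]}) : (forall v, p.@[v] = 0) -> p = 0.
Proof.
move=> p0; pose b := (msize p).
pose e (m : 'X_{1..N}) := (\sum_(x < N) m x * b ^ x)%N.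
have e_inj : {in msupp p &, injective e}.
  move=> m m' mp m'p /base_expansion_inj eqm; apply/mnmP/eqm => x.
    apply: leq_ltn_trans (msize_mdeg_lt mp); rewrite mdegE (bigD1 x) //=.
    exact: leq_addr.
  apply: leq_ltn_trans (msize_mdeg_lt m'p); rewrite mdegE (bigD1 x) //=.
  exact: leq_addr.
pose q : {poly K} := \sum_(m <- msupp p) p@_m *: 'X^(e m).
have q0 : q = 0.
  apply/eqP; apply/negPn/negP => nzq.
  pose s : seq K := [seq i%:R | i <- iota 0 (size q)].
  have us : uniq s by rewrite map_inj_uniq ?iota_uniq // => i j /eqP; rewrite eqr_nat => /eqP.
  have := max_poly_roots nzq _ us; rewrite size_map size_iota ltnn => /(_ _)/notF.
  apply; apply/allP => _ /mapP[i _ ->]; apply/rootP.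
  rewrite -[RHS](p0 (fun x => i%:R ^+ (b ^ x))) mevalE /q horner_sum.
  apply: eq_bigr => m _; rewrite hornerZ hornerXn; congr (_ * _).
  by rewrite -prodrXr; apply: eq_bigr => x _; rewrite -exprM mulnC.
apply/mpolyP => m; rewrite mcoeff0; have [mp|/memN_msupp_eq0 //] := boolP (m \in msupp p).
move/(congr1 (coefp (e m))): q0; rewrite /q raddf_sum /= (bigD1_seq m) //= coef0.
rewrite coefZ coefXn eqxx mulr1 big1_seq ?addr0 // => m' /andP[neq m'p].
rewrite coefZ coefXn; case: eqP => [/e_inj eqm|]; last by rewrite mulr0.
by rewrite eqm ?eqxx in neq.
Qed.

End Evaluation.

Section Blocks.
Context (C : numClosedFieldType) (k n : nat).
Local Notation nn := (fun _ : 'I_k => n).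
Local Notation P := {mpoly C[nvars nn]}.

Definition mblock (m : 'X_{1..nvars nn}) (i : 'I_k) : 'X_{1..n} :=
  [multinom m (mvar (n := nn) (i := i) j) | j < n].

Definition mjoin (u : 'I_k -> 'X_{1..n}) : 'X_{1..nvars nn} :=
  [multinom u (tag (enum_val x)) (tagged (enum_val x)) | x < nvars nn].

Lemma mjoinE u i j : mjoin u (mvar (n := nn) (i := i) j) = u i j.
Proof. by rewrite mnmE /mvar enum_rankK. Qed.

Lemma mvar_tagged (x : 'I_(nvars nn)) :
  mvar (n := nn) (i := tag (enum_val x)) (tagged (enum_val x)) = x.
Proof. by rewrite /mvar -[RHS]enum_valK; congr enum_rank; case: (enum_val x). Qed.

Lemma mjoinK u i : mblock (mjoin u) i = u i.
Proof. by apply/mnmP => j; rewrite mnmE mjoinE. Qed.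

Lemma mblockK m : mjoin (mblock m) = m.
Proof. by apply/mnmP => x; rewrite !mnmE mvar_tagged. Qed.

Lemma mblockD m m' i : mblock (m + m') i = (mblock m i + mblock m' i)%MM.
Proof. by apply/mnmP => j; rewrite !mnmE. Qed.

Lemma mdeg_mblock m i : mdeg (mblock m i) = multideg m i.
Proof. by rewrite mdegE; apply: eq_bigr => j _; rewrite mnmE. Qed.

Lemma mblock_mvar (i i' : 'I_k) (j : 'I_n) :
  mblock U_(mvar (n := nn) (i := i) j) i' = if i == i' then U_(j)%MM else 0%MM.
Proof.
apply/mnmP => j'; rewrite mnmE mnm1E mvar_eq -tag_eqE /tag_eq /=.
have [<-|neq] := eqVneq i i'; last by rewrite mnm0E.
by rewrite mnm1E tagged_asE.
Qed.

Lemma big_nvars (R : Type) (idx : R) (op : Monoid.com_law idx) (F : 'I_(nvars nn) -> R) :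
  \big[op/idx]_x F x = \big[op/idx]_(i < k) \big[op/idx]_(j < n) F (mvar (n := nn) (i := i) j).
Proof.
rewrite [RHS]sig_big_dep /= (reindex (fun x : 'I_(nvars nn) => enum_val x)) /=; last first.
  exact/onW_bij/enum_val_bij.
by apply: eq_bigr => x _; rewrite mvar_tagged.
Qed.

Definition block_poly (i : 'I_k) (g : {mpoly C[n]}) : P :=
  g \mPo [tuple 'X_(mvar (n := nn) (i := i) j) | j < n].

(** The factors involve disjoint sets of variables: in the expanded product every
    monomial is obtained in exactly one way, from its own blocks. *)
Lemma mcoeff_prod_block (g : 'I_k -> {mpoly C[n]}) m :
  (\prod_(i < k) block_poly i (g i))@_m = \prod_(i < k) (g i)@_(mblock m i).
Proof.
pose b := (\max_(i < k) maxn (msize (g i)) (mdeg (mblock m i)).+1)%N.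
have leb i : (maxn (msize (g i)) (mdeg (mblock m i)).+1 <= b)%N by exact: (leq_bigmax i).
have blockE i : block_poly i (g i) = \sum_(u : 'X_{1..n < b}) (g i)@_u *:
    'X_[mjoin (fun i' => if i == i' then val u else 0%MM)].
  rewrite /block_poly (comp_mpolywE _ (leq_trans (leq_maxl _ _) (leb i))).
  apply: eq_bigr => u _; congr (_ *: _); rewrite mpolyXE_id big_nvars /=.
  rewrite [RHS](bigD1 i) //= [X in _ * X]big1 ?mulr1.
    by apply: eq_bigr => j _; rewrite tnth_mktuple mjoinE eqxx.
  move=> i' neq; apply: big1 => j _.
  by rewrite mjoinE eq_sym (negPf neq) mnm0E expr0.
under eq_bigr do rewrite blockE.
rewrite bigA_distr_bigA /=.
have termE (u : {ffun 'I_k -> 'X_{1..n < b}}) : \prod_i ((g i)@_(u i) *: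
      'X_[mjoin (fun i' => if i == i' then val (u i) else 0%MM)] : P) =
    (\prod_i (g i)@_(u i)) *: 'X_[mjoin (fun i => val (u i))].
  rewrite scaler_prod mprodXE; congr (_ *: 'X_[_]); apply/mnmP => x.
  rewrite mnm_sumE -(mvar_tagged x) mjoinE (bigD1 (tag (enum_val x))) //=.
  rewrite mjoinE eqxx big1 ?addn0 // => i neq.
  by rewrite mjoinE (negPf neq) mnm0E.
under eq_bigr do rewrite termE.
rewrite raddf_sum /=; under eq_bigr do rewrite mcoeffZ mcoeffX.
have ltm i : (mdeg (mblock m i) < b)%N by apply: leq_trans (leq_maxr _ _) (leb i).
rewrite (bigD1 [ffun i => BMultinom (ltm i)]) //= [X in _ + X]big1 ?addr0.
  rewrite (_ : mjoin _ = m) ?eqxx ?mulr1; last first.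
    by apply/mnmP => x; rewrite mnmE ffunE /= mnmE mvar_tagged.
  by apply: eq_bigr => i _; rewrite ffunE.
move=> u /eqP neq; case: eqP => [um|]; last by rewrite mulr0.
case: neq; apply/ffunP => i; apply/val_inj; rewrite ffunE /=.
by rewrite -um mjoinK.
Qed.

Lemma mcoeff_tensor_power (f : {mpoly C[n]}) m :
  (tensor_power k f)@_m = \prod_(i < k) f@_(mblock m i).
Proof. exact: (mcoeff_prod_block (fun=> f)). Qed.

Lemma multihomog_tensor_power d (f : {mpoly C[n]}) :
  f \is d.-homog -> multihomog (fun=> d) (tensor_power k f).
Proof.
move=> hf; apply: multihomogP => m hm; rewrite mcoeff_tensor_power.
have [i /eqP] : exists i, multideg m i <> d by apply/existsNP.
rewrite -mdeg_mblock => /(dhomog_nemf_coeff hf) fi0.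
by rewrite (bigD1 i) //= fi0 mul0r.
Qed.

End Blocks.

Section Multinomial.
Context (C : numClosedFieldType).

Definition multinomial n (u : 'X_{1..n}) : C :=
  (mdeg u)`!%:R / (\prod_(j < n) (u j)`!)%:R.

Lemma multinomial_neq0 n (u : 'X_{1..n}) : multinomial u != 0.
Proof.
rewrite mulf_neq0 ?invr_eq0 ?pnatr_eq0 -?lt0n ?fact_gt0 //.
by apply: prodn_gt0 => j; exact: fact_gt0.
Qed.

(** The multinomial theorem, by induction on [d]. After multiplication by the
    factorials of the exponents, the term of ['X_j] contributes the fraction
    [u j / d] of the total, and these fractions add up to 1. *)
Lemma mcoeff_linear_power n (a : 'I_n -> C) d (u : 'X_{1..n}) :
  ((\sum_j a j *: 'X_j) ^+ d)@_u =
  if mdeg u == d then multinomial u * \prod_j a j ^+ u j else 0.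
Proof.
have hom (b : nat) : (\sum_j a j *: 'X_j : {mpoly C[n]}) ^+ b \is b.-homog.
  rewrite -[b in b.-homog]mul1n; apply: dhomogMn.
  apply: rpred_sum => j _; apply: dhomogZ; by rewrite dhomogX /= mdeg1.
case: eqP => [du|/eqP neq]; last exact: (dhomog_nemf_coeff (hom d)).
rewrite -du {du d}.
have nz (v : 'X_{1..n}) : (\prod_(j < n) (v j)`!)%:R != 0 :> C.
  by rewrite pnatr_eq0 -lt0n; apply: prodn_gt0 => j; exact: fact_gt0.
apply/(mulIf (nz u)); rewrite /multinomial mulrAC divfK //.
have [d du] : exists d, mdeg u = d by exists (mdeg u).
rewrite du; elim: d u du => [|d IH] u du.
  move/eqP: du; rewrite mdeg_eq0 => /eqP ->; rewrite expr0 mcoeff1 eqxx.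
  rewrite !big1 ?mul1r // => j _; rewrite mnm0E //.
rewrite exprS mulr_suml raddf_sum /= mulr_suml.
have term j : ((a j *: 'X_j) * (\sum_j a j *: 'X_j) ^+ d)@_u *
   (\prod_(j < n) (u j)`!)%:R = (u j)%:R * (d`!%:R * \prod_j a j ^+ u j) :> C.
  rewrite -scalerAl mcoeffZ.
  have [uj0|uj_gt0] := posnP (u j).
    rewrite uj0 mul0r mulrC (_ : _@_u = 0) ?mulr0 //.
    apply: memN_msupp_eq0; apply/negP; rewrite mulrC.
    rewrite (perm_mem (msuppMX _ _)) => /mapP[v _ /mnmP/(_ j)].
    by rewrite uj0 mnmDE mnm1E eqxx.
  pose v := (u - U_(j))%MM.
  have uE : u = (v + U_(j))%MM by rewrite submK // lep1mP -lt0n.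
  have dv : mdeg v = d by apply/eqP; rewrite -eqSS -du uE mdegD mdeg1 addn1.
  have uj : u j = (v j).+1 by rewrite uE mnmDE mnm1E eqxx addn1.
  have neqj j' : j' != j -> u j' = v j'.
    by move=> neq; rewrite uE mnmDE mnm1E eq_sym (negPf neq) addn0.
  have -> : ('X_j * (\sum_j a j *: 'X_j) ^+ d)@_u = ((\sum_j a j *: 'X_j) ^+ d)@_v :> C.
    by rewrite mulrC [in LHS]uE addmC mcoeffMX.
  have -> : (\prod_(j < n) (u j)`! = (u j) * \prod_(j < n) (v j)`!)%N.
    rewrite (bigD1 j) //= [in RHS](bigD1 j) //= uj factS mulnA; congr (_ * _)%N.
    by apply: eq_bigr => j' /neqj ->.
  have -> : \prod_j a j ^+ u j = a j * \prod_j a j ^+ v j.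
    rewrite (bigD1 j) //= [in RHS](bigD1 j) //= uj exprS mulrA; congr (_ * _).
    by apply: eq_bigr => j' /neqj ->.
  rewrite natrM mulrACA [_ * (u j)%:R]mulrC -!mulrA; congr (_ * _).
  by rewrite IH // mulrCA.
rewrite (eq_bigr _ (fun j _ => term j)).
by rewrite -mulr_suml -natr_sum -mdegE du factS natrM mulrA.
Qed.

Context (k n : nat).
Local Notation nn := (fun _ : 'I_k => n).
Local Notation P := {mpoly C[nvars nn]}.

Definition multinomial_prod (m : 'X_{1..nvars nn}) : C :=
  \prod_(i < k) multinomial (mblock m i).

Lemma mcoeff_segre_veronese (d : 'I_k -> nat) (v : 'I_(nvars nn) -> C) m :
  (segre_veronese d v)@_m =
  if [forall i, multideg m i == d i] then
    multinomial_prod m * \prod_x v x ^+ m x else 0.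
Proof.
have -> : segre_veronese d v = \prod_(i < k) block_poly i
    ((\sum_j v (mvar (n := nn) (i := i) j) *: 'X_j) ^+ d i).
  apply: eq_bigr => i _; rewrite /block_poly rmorphXn /= raddf_sum /=; congr (_ ^+ _).
  apply: eq_bigr => j _; rewrite linearZ /= comp_mpolyXU -tnth_nth tnth_mktuple //.
rewrite mcoeff_prod_block (eq_bigr _ (fun i _ => mcoeff_linear_power _ _ _)).
under eq_bigr do rewrite mdeg_mblock.
case: forallP => [h|/existsNP[i /negP/negPf h]]; last by rewrite (bigD1 i) //= h mul0r.
rewrite big_nvars -big_split /=; apply: eq_bigr => i _; rewrite h; congr (_ * _).
by apply: eq_bigr => j _; rewrite mnmE.
Qed.

Lemma lform_eq_mcoeff N (p q : {mpoly C[N]}) w1 w2 :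
  (forall m, p@_m * w1 m = q@_m * w2 m) -> lform w1 p = lform w2 q.
Proof.
move=> h; pose b := maxn (msize p) (msize q).
rewrite (lformwE w1 (leq_maxl _ _ : (_ <= b)%N)) (lformwE w2 (leq_maxr _ _ : (_ <= b)%N)).
by apply: eq_bigr.
Qed.

(** By the multinomial theorem the displayed coefficients give a form with the
    required values, and it is the only one because a polynomial over an infinite
    field is determined by its values. *)
Lemma span_hyperplaneP (d : 'I_k -> nat) (lambda : {scalar P}) (G : P) :
    (forall v, G.@[v] = lambda (segre_veronese d v)) <->
  (forall m, G@_m = if [forall i, multideg m i == d i] then
     multinomial_prod m * lambda 'X_[m] else 0).
Proof.
have lamE G' v : (forall m, G'@_m = if [forall i, multideg m i == d i] then
     multinomial_prod m * lambda 'X_[m] else 0) ->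
  G'.@[v] = lambda (segre_veronese d v).
  move=> G'E; rewrite [RHS]scalar_lform mevalE -/(lform (fun m => \prod_i v i ^+ m i) G').
  apply: lform_eq_mcoeff => m; rewrite mcoeff_segre_veronese G'E.
  by case: ifP; rewrite ?mul0r // mulrAC.
split=> [Gv|/lamE //].
pose b := (\sum_i d i).+1.
pose E m := if [forall i, multideg m i == d i] then
     multinomial_prod m * lambda 'X_[m] else 0.
pose G' : P := \sum_(m : 'X_{1..(nvars nn) < b}) E m *: 'X_[m].
have G'E m : G'@_m = E m.
  have [|leb] := ltnP (mdeg m) b; first by move=> lt; rewrite /G' mcoeff_mpoly.
  rewrite /E ifF; last first.
    apply/negP => /forallP h; move: leb; rewrite ltnNge => /negP; apply.
    rewrite mdegE big_nvars /=; apply: leq_sum => i _; rewrite -(eqP (h i)) //.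
  rewrite raddf_sum big1 //= => u _; rewrite mcoeffZ mcoeffX.
  by case: eqP => [um|]; rewrite ?mulr0 //; have := bmdeg u; rewrite um ltnNge leb.
suff -> : G = G' by [].
apply/eqP; rewrite -subr_eq0; apply/eqP/meval_inj => v.
by rewrite mevalB Gv (lamE G') // subrr.
Qed.

End Multinomial.

(** * From Hankel matrices to schemes *)

(** The algebraic form of having cactus rank at most [#|T|]. The function [L]
    gives the values on monomials of a functional on polynomials; the first
    condition says that its Hankel matrix factors through a space with basis
    [T], hence that the functional factors through an algebra of that dimension;
    the second one that the linear form with coefficients [y] is 1 in this
    algebra, hence that it vanishes nowhere on the scheme of the algebra; the
    third one that [g] is the value of the functional at the [d]-th power of the
    universal linear form. *)
Definition hankel_rep (C : numClosedFieldType) (T : finType) (n d : nat)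
    (g : {mpoly C[n]}) : Prop :=
  exists (L : 'X_{1..n} -> C) (al be : T -> 'X_{1..n} -> C) (y : 'I_n -> C),
  [/\ forall m m', L (m + m')%MM = \sum_s al s m * be s m',
      forall m, \sum_j y j * L (m + U_(j))%MM = L m
    & forall m, mdeg m = d -> g@_m = multinomial C m * L m].

Section ApolarIdeal.
Context (C : numClosedFieldType) (k n : nat) (J T : finType).
Local Notation nn := (fun _ : 'I_k => n).
Local Notation P := {mpoly C[nvars nn]}.
Context (L : J -> 'X_{1..n} -> C) (al be : J -> T -> 'X_{1..n} -> C).
Context (y : J -> 'I_n -> C).
Hypothesis L_hankel : forall j m m', L j (m + m')%MM = \sum_s al j s m * be j s m'.
Hypothesis L_norm : forall j m, \sum_l y j l * L j (m + U_(l))%MM = L j m.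
Implicit Types (F G : P) (D E : 'I_k -> nat) (m u : 'X_{1..nvars nn}).

Definition tensor_fun j m : C := \prod_(i < k) L j (mblock m i).

(** The functional of [tensor_fun], shifted by the monomial [m'] and restricted to
    multidegree [D]: its vanishing for all [D] is a condition on each
    multihomogeneous component separately. *)
Definition graded_fun j D m' m : C :=
  if [forall i, multideg m i == D i] then tensor_fun j (m + m')%MM else 0.

(** The multigraded ideal of the union over [j] of the product schemes defined by
    the [k]-th tensor powers of the functionals [L j]. *)
Definition apolar : set P :=
  [set F | forall j D m', lform (graded_fun j D m') F = 0]%classic.

Lemma apolarM F G : apolar G -> apolar (F * G).
Proof.
move=> aG j D m'; rewrite {1}[F]mpolyE mulr_suml linear_sum big1 //= => a _.
rewrite -scalerAl linearZ /= lform_mulX.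
suff -> : lform (fun u => graded_fun j D m' (a + u)%MM) G = 0 by rewrite mulr0.
have [/forallP leD|/forallPn[i nle]] := boolP [forall i, multideg a i <= D i]%N.
  rewrite -(aG j (fun i => D i - multideg a i)%N (a + m')%MM).
  apply: eq_lform => u _; rewrite /graded_fun.
  rewrite (eq_forallb (P2 := fun i => multideg u i == D i - multideg a i)%N).
    by rewrite [(u + (a + _))%MM]addmA [(u + a)%MM]addmC.
  by move=> i; rewrite multidegD -[RHS](eqn_add2l (multideg a i)) subnKC.
rewrite /lform big1 // => u _; rewrite /graded_fun ifF ?mulr0 //.
apply/negP => /forallP/(_ i); rewrite multidegD => /eqP Di.
by rewrite -Di leq_addr in nle.
Qed.

Lemma apolar_mhcomp F D : apolar F -> apolar (mhcomp D F).
Proof.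
move=> aF j E m'.
rewrite (lform_eq_mcoeff (q := F)
  (w2 := fun m => if [forall i, D i == E i] then graded_fun j E m' m else 0)).
  by case: [forall i, D i == E i]; [exact: aF|rewrite /lform big1 // => m _; rewrite mulr0].
move=> m; rewrite mcoeff_mhcomp.
case: ifP => [/forallP mD|/forallP nmD].
  rewrite /graded_fun (eq_forallb (P2 := fun i => D i == E i)); last first.
    by move=> i; rewrite (eqP (mD i)).
  by case: ifP.
case: ifP => [/forallP DE|_]; last by rewrite mul0r mulr0.
rewrite /graded_fun ifF ?mul0r ?mulr0 //; apply/negP => /forallP mE.
by apply: nmD => i; rewrite (eqP (mE i)) (eqP (DE i)).
Qed.

(** The invariance of [L j] under the linear form [y j], in the factor [i]. *)
Lemma graded_fun_linear_form j D m' i F :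
  lform (graded_fun j D m') F =
  lform (graded_fun j (fun i' => D i' + (i == i'))%N m')
    (linear_form (n := nn) (i := i) (y j) * F).
Proof.
rewrite mulr_suml linear_sum /=.
under [RHS]eq_bigr do rewrite -scalerAl linearZ /= lform_mulX.
rewrite /lform; under [RHS]eq_bigr do rewrite mulr_sumr.
rewrite exchange_big /=; apply: eq_bigr => u _.
under eq_bigr do rewrite mulrCA; rewrite -mulr_sumr; congr (_ * _).
rewrite /graded_fun; under eq_bigr => l _.
  rewrite (eq_forallb (P2 := fun i => multideg u i == D i)%N); last first.
    by move=> i'; rewrite multidegD multideg_mvar addnC eqn_add2r.
  over.
case: ifP => _; last by rewrite big1 // => l _; rewrite mulr0.
rewrite /tensor_fun (bigD1 i) //= -L_norm mulr_suml; apply: eq_bigr => l _.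
rewrite [in RHS](bigD1 i) //= -mulrA; congr (_ * (L j _ * _)).
  by rewrite !mblockD mblock_mvar eqxx addmC addmA.
apply: eq_bigr => i' /negPf neq; congr (L j _).
by rewrite !mblockD mblock_mvar eq_sym neq add0m.
Qed.

(** The product over all factors of the linear forms [y j] is in the irrelevant
    ideal, and acts as the identity for the functional of [j]. The forms [y j]
    may vary with [j]. *)
Lemma apolar_sat F :
    (forall c : 'I_k -> 'I_n,
       apolar ((\prod_(i < k) 'X_(mvar (n := nn) (i := i) (c i))) * F)) ->
  apolar F.
Proof.
move=> aF j D m'.
have [E ->] : exists E, lform (graded_fun j D m') F = lform (graded_fun j E m')
    ((\prod_(i <- enum 'I_k) linear_form (n := nn) (i := i) (y j)) * F).
  elim: (enum _) => [|i s [E ->]]; first by exists D; rewrite big_nil mul1r.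
  exists (fun i' => E i' + (i == i'))%N.
  by rewrite (graded_fun_linear_form _ _ _ i) big_cons mulrA.
rewrite big_enum /= bigA_distr_bigA mulr_suml linear_sum big1 // => c _.
by rewrite scaler_prod -scalerAl linearZ /= aF mulr0.
Qed.

Lemma apolar_ideal : subscheme_ideal apolar.
Proof.
split; [|move=> F G aF aG|exact: apolarM|exact: apolar_mhcomp|exact: apolar_sat] => j D m'.
  exact: linear0.
by rewrite linearD /= aF aG addr0.
Qed.

(** The Hankel matrix of a tensor power is the entrywise product of the Hankel
    matrices of the factors, so its rank is at most [#|T| ^ k]. A form of
    multidegree [D] is in the ideal as soon as the left factors [A] of all these
    Hankel matrices vanish on it, which imposes [#|J| * #|T| ^ k] linear
    conditions. *)
Lemma apolar_indep_le D r (b : 'I_r -> P) :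
  indep_family apolar D b -> (r <= #|J| * #|T| ^ k)%N.
Proof.
move=> [hb indb]; pose Q := (J * {ffun 'I_k -> T})%type.
have <- : #|{: Q}| = (#|J| * #|T| ^ k)%N by rewrite card_prod card_ffun card_ord.
pose A (q : Q) m := \prod_(i < k) al q.1 (q.2 i) (mblock m i).
pose M := \matrix_(s < r, q < #|{: Q}|) lform (A (enum_val q)) (b s).
suff /eqP <- : row_free M by apply: rank_leq_col.
apply: inj_row_free => c cM; apply: indb; set F := \sum_s _.
have hF : multihomog D F by apply: multihomog_sum => s _; apply: multihomogZ.
have AF q : lform (A q) F = 0.
  have /rowP/(_ (enum_rank q)) := cM; rewrite !mxE => <-.
  by rewrite linear_sum; apply: eq_bigr => s _; rewrite linearZ /= mxE enum_rankK.
move=> j E m'; rewrite /lform.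
have [/forallP DE|/forallPn[i neq]] := boolP [forall i, D i == E i]; last first.
  rewrite big1_seq // => m /andP[_ /hF mD].
  by rewrite /graded_fun ifF ?mulr0 //; apply/negP => /forallP/(_ i); rewrite mD (negPf neq).
transitivity (\sum_(m <- msupp F) F@_m * \sum_(u : {ffun 'I_k -> T})
    A (j, u) m * \prod_(i < k) be j (u i) (mblock m' i)).
  apply: eq_big_seq => m /hF mD; congr (_ * _); rewrite /graded_fun ifT; last first.
    by apply/forallP => i; rewrite mD.
  rewrite /tensor_fun; under eq_bigr do rewrite mblockD L_hankel.
  rewrite bigA_distr_bigA; apply: eq_bigr => u _.
  by rewrite big_split.
under eq_bigr do rewrite mulr_sumr; rewrite exchange_big big1 //= => u _.
under eq_bigr do rewrite mulrA; rewrite -mulr_suml.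
by rewrite -/(lform _ F) AF mul0r.
Qed.

End ApolarIdeal.

(** This contains both the subadditivity of cactus rank and its submultiplicativity
    under tensor powers. A functional [lambda] whose section [G] is in the
    apolar ideal vanishes on each [tensor_power k (g j)], because its value
    there is the value on [G] of the functional of [j]. *)
Lemma cactus_scheme_of_hankel (C : numClosedFieldType) (k n d : nat)
    (J T : finType) (g : J -> {mpoly C[n]}) (c : J -> C) :
    (forall j, g j \is d.-homog) -> (forall j, hankel_rep T d (g j)) ->
  exists2 r, (r <= #|J| * #|T| ^ k)%N &
    in_span_of_length (fun=> d) (\sum_j c j *: tensor_power k (g j)) r.
Proof.
move=> hg /choice[L /choice[al /choice[be /choice[y Ly]]]].
have L_hankel j : forall m m', L j (m + m')%MM = \sum_s al j s m * be j s m'.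
  by have [] := Ly j.
have L_norm j : forall m, \sum_l y j l * L j (m + U_(l))%MM = L j m by have [] := Ly j.
have idI := @apolar_ideal C k n J L y L_norm.
have [r le_r zr] := zero_dim_of_bounded idI (apolar_indep_le L_hankel).
exists r => //; exists (apolar L); split=> //.
move=> lambda G /span_hyperplaneP GE aG.
rewrite linear_sum big1 //= => j _; rewrite linearZ /= scalar_lform.
rewrite (lform_eq_mcoeff (q := G) (w2 := graded_fun L j (fun=> d) 0%MM)).
  by rewrite aG mulr0.
move=> m; rewrite GE /graded_fun addm0; case: ifP => [/forallP md|/negP md].
  rewrite mcoeff_tensor_power /tensor_fun /multinomial_prod mulrAC -big_split /=.
  congr (_ * _); apply: eq_bigr => i _; have [_ _ -> //] := Ly j.
  by rewrite mdeg_mblock (eqP (md i)).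
rewrite (multihomog_coeff (multihomog_tensor_power (hg j))) ?mul0r // => h.
by apply: md; apply/forallP => i; rewrite h.
Qed.

(** * From schemes to Hankel matrices *)

(** A functional on the rows of [Z] that respects their linear relations extends
    to the whole space. *)
Lemma ex_functional_of_kernel (K : fieldType) (N r : nat) (Z : 'M[K]_(N, r)) (tau : 'cV_N) :
    (forall a : 'rV_N, a *m Z = 0 -> a *m tau = 0) ->
  exists p : 'cV_r, Z *m p = tau.
Proof.
move=> kertau; suff /submxP[p tauE] : (tau^T <= Z^T)%MS.
  by exists p^T; rewrite -[tau]trmxK tauE trmx_mul trmxK.
rewrite submxE; apply/eqP/trmx_inj; rewrite trmx_mul trmxK trmx0.
apply/row_matrixP => i; rewrite row_mul row0; apply: kertau.
by rewrite -row_mul -[X in _ *m X]trmxK -trmx_mul mulmx_coker trmx0 row0.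
Qed.

Section HankelOfScheme.
Context (C : numClosedFieldType) (n r d N0 : nat).
Local Notation nn := (fun _ : 'I_1 => n).
Local Notation P := {mpoly C[nvars nn]}.
Implicit Types (F G : P) (m : 'X_{1..nvars nn}).
Context (I : set P) (idI : subscheme_ideal I).
Context (hilbI : forall e, (N0 <= e)%N -> hilbert_value I (fun=> e) r).

Lemma multideg1 m i : multideg m i = mdeg m.
Proof. by rewrite mdegE big_nvars big_ord1 (ord1 i). Qed.

Lemma multihomog1X e m : mdeg m = e -> multihomog (fun=> e) ('X_[m] : P).
Proof.
by move=> <-; apply: (eq_multihomog (@multihomogX _ _ _ m)) => i; rewrite multideg1.
Qed.

Lemma ex_regular_linear_form :
  exists y : 'I_n -> C, regular_mod I (linear_form (n := nn) (i := ord0) y).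
Proof.
apply: (@ex_regular_form _ _ _ _ idI (fun=> N0) r) => D leD r' b indb.
apply: (@hilbert_indep_le _ _ _ _ idI (fun=> D ord0) _ _ b); first exact: hilbI.
case: indb => hb indb; split=> // s.
by apply: (eq_multihomog (hb s)) => i; rewrite (ord1 i).
Qed.

Context (y : 'I_n -> C).
Let l : P := linear_form (n := nn) (i := ord0) y.
Hypothesis reg_l : regular_mod I l.

Lemma multihomog1_pow e : multihomog (fun=> e) (l ^+ e).
Proof.
have h : multihomog (fun i' => (ord0 == i' :> 'I_1) * e)%N (l ^+ e).
  exact/multihomogXn/multihomog_linear_form.
by apply: (eq_multihomog h) => i; rewrite (ord1 i) mul1n.
Qed.

Arguments multihomog1_pow : clear implicits.

Lemma multihomog1M a b e F G : multihomog (fun=> a) F -> multihomog (fun=> b) G ->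
  (a + b = e)%N -> multihomog (fun=> e) (F * G).
Proof. by move=> hF hG <-; exact: (multihomogM hF hG). Qed.

Lemma regular_pow e : regular_mod I (l ^+ e).
Proof.
elim: e => [|e IH] D F hF; first by rewrite expr0 mul1r.
rewrite exprS -mulrA => /reg_l-/(_ _ (multihomogM (multihomog1_pow e) hF)).
exact: IH hF.
Qed.

Arguments regular_pow : clear implicits.

Lemma no_indep e N (b : 'I_N -> P) : (N0 <= e)%N -> indep_family I (fun=> e) b -> (N <= r)%N.
Proof. by move=> /hilbI; exact: (hilbert_indep_le idI). Qed.

Section Basis.
Context (e0 : nat) (le_e0 : (N0 <= e0)%N) (b : 'I_r -> P).
Hypothesis b_indep : indep_family I (fun=> e0) b.

(** Since [l] is regular and the Hilbert function is constant from [N0] on,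
    multiplication by [l ^+ e] is an isomorphism modulo [I] from degree [e0] to
    degree [e + e0]. Hence [z] can be read as the coordinate vector of the
    fraction [F / l ^+ e] in the basis [b] of the degree [e0] part, which plays
    the role of the ring of functions on the scheme. *)
Definition coords e F (z : 'rV[C]_r) := I (F - \sum_s z 0 s *: (l ^+ e * b s)).

Lemma coords0 e F : coords e F 0 = I F.
Proof.
rewrite /coords [X in F - X](_ : _ = 0) ?subr0 //.
by apply: big1 => s _; rewrite mxE scale0r.
Qed.

Lemma indep_shift e : indep_family I (fun=> (e + e0)%N) (fun s => l ^+ e * b s).
Proof.
have [hb indb] := b_indep; split=> [s|c].
  exact: multihomog1M (multihomog1_pow e) (hb s) _.
have -> : \sum_s c 0 s *: (l ^+ e * b s) = l ^+ e * \sum_s c 0 s *: b s.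
  by rewrite mulr_sumr; apply: eq_bigr => s _; rewrite scalerAr.
move=> /regular_pow Ic; apply/indb/(Ic (fun=> e0)).
by apply: multihomog_sum => s _; apply: multihomogZ.
Qed.

Lemma ex_coords e F : multihomog (fun=> (e + e0)%N) F -> exists z, coords e F z.
Proof.
move=> hF; have [|z [Iz _]] := indep_family_spans idI (indep_shift e) _ hF.
  by move=> b' /no_indep; rewrite ltnn => h; have := h (leq_trans le_e0 (leq_addl _ _)).
by exists z.
Qed.

Lemma coords_inj e F z z' : coords e F z -> coords e F z' -> z = z'.
Proof.
move=> Iz Iz'; apply/esym/eqP; rewrite -subr_eq0; apply/eqP/(indep_shift e).2.
move: (idealB idI Iz Iz'); rewrite opprB addrC addrA subrK -sumrB.
by congr (I _); apply: eq_bigr => s _; rewrite !mxE scalerBl.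
Qed.

Lemma coords_lin e (J : finType) (c : J -> C) (F : J -> P) (z : J -> 'rV_r) :
    (forall j, coords e (F j) (z j)) ->
  coords e (\sum_j c j *: F j) (\sum_j c j *: z j).
Proof.
move=> Iz; rewrite /coords.
have -> : \sum_s (\sum_j c j *: z j) 0 s *: (l ^+ e * b s) =
    \sum_j c j *: \sum_s z j 0 s *: (l ^+ e * b s).
  under eq_bigr do rewrite summxE scaler_suml; rewrite exchange_big /=.
  apply: eq_bigr => j _; rewrite scaler_sumr; apply: eq_bigr => s _.
  by rewrite mxE scalerA.
rewrite -sumrB; apply: ideal_sum => // j _; rewrite -scalerBr.
by apply: idealZ => //; apply: Iz.
Qed.

Lemma coords_shift e a F z : coords e F z -> coords (a + e) (l ^+ a * F) z.
Proof.
move=> /(idealM idI (l ^+ a)); rewrite /coords mulrBr mulr_sumr.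
by congr (I (_ - _)); apply: eq_bigr => s _; rewrite exprD -scalerAr mulrA.
Qed.

Lemma coords_congr e F G z : I (F - G) -> coords e G z -> coords e F z.
Proof.
by move=> IFG /(idealD idI IFG); rewrite addrA subrK.
Qed.

Lemma coords_unshift e a F z : multihomog (fun=> (e + e0)%N) F ->
  coords (a + e) (l ^+ a * F) z -> coords e F z.
Proof.
move=> hF Iz; apply: (regular_pow a (fun=> (e + e0)%N)).
  apply: multihomogD => //; rewrite -scaleN1r; apply: multihomogZ.
  by apply: multihomog_sum => s _; apply/multihomogZ/(indep_shift e).1.
move: Iz; rewrite /coords mulrBr mulr_sumr.
by congr (I (_ - _)); apply: eq_bigr => s _; rewrite exprD -scalerAr mulrA.
Qed.

(* A m is multiplication by 'X_[m] / l ^+ mdeg m on the degree e0 part *)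
Context (A : 'X_{1..nvars nn} -> 'M[C]_r).
Hypothesis AP : forall m s, coords (mdeg m) ('X_[m] * b s) (row s (A m)).

Lemma coords_mul m e F z : coords e F z -> coords (mdeg m + e) ('X_[m] * F) (z *m A m).
Proof.
move=> Iz; rewrite addnC.
apply: (coords_congr (G := \sum_s z 0 s *: (l ^+ e * ('X_[m] * b s)))).
  have := idealM idI 'X_[m] Iz; rewrite mulrBr mulr_sumr.
  by congr (I (_ - _)); apply: eq_bigr => s _; rewrite -scalerAr mulrCA.
rewrite mulmx_sum_row; apply: coords_lin => s.
exact: coords_shift.
Qed.

Lemma mult_matrixD m m' : A (m + m')%MM = A m *m A m'.
Proof.
apply/row_matrixP => s; rewrite row_mul; apply: (coords_inj (AP _ _)).
by rewrite addmC mpolyXD -mulrA mdegD; apply: coords_mul.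
Qed.

Lemma coords_basis s : coords 0 (b s) (delta_mx 0 s).
Proof.
rewrite /coords (bigD1 s) //= mxE !eqxx scale1r mul1r big1.
  by rewrite addr0 subrr; apply: subscheme_ideal0.
by move=> t neq; rewrite mxE eqxx (negPf neq) scale0r.
Qed.

Lemma mult_matrix_norm : \sum_j y j *: A U_(mvar (n := nn) (i := ord0) j) = 1%:M.
Proof.
apply/row_matrixP => s; rewrite linear_sum /=.
apply: (@coords_inj 1 (l * b s)).
  have -> : l * b s = \sum_j y j *: ('X_(mvar (n := nn) (i := ord0) j) * b s).
    by rewrite /l /linear_form mulr_suml; apply: eq_bigr => j _; rewrite -scalerAl.
  have -> : \sum_j row s (y j *: A U_(mvar (n := nn) (i := ord0) j)) =
      \sum_j y j *: row s (A U_(mvar (n := nn) (i := ord0) j)).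
    by apply: eq_bigr => j _; rewrite linearZ.
  by apply: coords_lin => j; have := AP U_(mvar (n := nn) (i := ord0) j) s; rewrite mdeg1.
by rewrite row1; have := coords_shift 1 (coords_basis s); rewrite expr1.
Qed.


(* q represents the unit, as the fraction l ^+ e0 / 1 of degree e0 *)
Context (le_d : (d <= e0)%N) (q : 'rV[C]_r) (qP : coords 0 (l ^+ e0) q).
Context (t : P) (t_span : in_linear_span (fun=> d) I t).

Lemma coords_monomial m : mdeg m = d ->
  coords 0 ('X_[m] * l ^+ (e0 - d)) (q *m A m).
Proof.
move=> md; apply: (@coords_unshift 0 d).
  by apply: multihomog1M (multihomog1X md) (multihomog1_pow _) _; rewrite subnKC.
have := coords_mul m qP; rewrite md addn0; congr (coords _ _ _).
by rewrite mulrCA -exprD subnKC.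
Qed.

(** The form [G] is the pullback of the functional with values
    [G@_m / multinomial_prod C m] on monomials, and the apolarity pairing of [G]
    with [t] is symmetric. *)
Lemma span_pairing G : multihomog (fun=> d) G -> I G ->
  lform (fun m => t@_m / multinomial_prod C m) G = 0.
Proof.
move=> hG IG; rewrite -(t_span (lambda := lform (fun m => G@_m / multinomial_prod C m)) _ IG).
  by apply: lform_eq_mcoeff => m; rewrite mulrCA.
apply/span_hyperplaneP => m; rewrite /= lformX.
case: ifP => [_|/negP nd].
  by rewrite mulrC divfK //; apply/prodf_neq0 => i _; exact: multinomial_neq0.
by apply: multihomog_coeff hG _ => h; apply: nd; apply/forallP => i; rewrite h.
Qed.

(** By [span_pairing], the values of [t] on the monomials of degree [d] respect
    the linear relations between these monomials modulo [I]. By regularity of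
    [l], these are the relations between the vectors [q *m A m]. *)
Lemma ex_span_functional : exists p : 'cV[C]_r, forall m, mdeg m = d ->
  t@_m = multinomial_prod C m * (q *m A m *m p) 0 0.
Proof.
pose X := 'X_{1..(nvars nn) < d.+1}.
pose mon (i : 'I_#|{: X}|) : 'X_{1..nvars nn} := val (enum_val i).
pose tau m := t@_m / multinomial_prod C m.
have [] := @ex_functional_of_kernel C #|{: X}| r
  (\matrix_i (if mdeg (mon i) == d then q *m A (mon i) else 0))
  (\col_i (if mdeg (mon i) == d then tau (mon i) else 0)) => [a aZ|p pP].
  pose F i : P := if mdeg (mon i) == d then 'X_[mon i] else 0.
  have hF i : multihomog (fun=> d) (F i).
    rewrite /F; case: eqP => [/multihomog1X|_] //; exact: multihomog0.
  have hG : multihomog (fun=> d) (\sum_i a 0 i *: F i).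
    by apply: multihomog_sum => i _; apply: multihomogZ.
  have IG : I (\sum_i a 0 i *: F i).
    apply: (regular_pow (e0 - d) _ _ hG); rewrite mulr_sumr.
    have : coords 0 (\sum_i a 0 i *: (F i * l ^+ (e0 - d))) 0.
      rewrite -aZ mulmx_sum_row; apply: coords_lin => i; rewrite rowK /F.
      case: eqP => [/coords_monomial //|_].
      by rewrite mul0r coords0; exact: subscheme_ideal0.
    rewrite coords0.
    by congr (I _); apply: eq_bigr => i _; rewrite -scalerAr mulrC.
  apply/rowP => z; rewrite !mxE -[RHS](span_pairing hG IG) linear_sum.
  apply: eq_bigr => i _; rewrite linearZ /= mxE /F.
  by case: ifP => _; [rewrite lformX|rewrite linear0].
exists p => m md; have lt_m : (mdeg m < d.+1)%N by rewrite md.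
pose i := enum_rank (BMultinom lt_m : X).
have moni : mon i = m by rewrite /mon enum_rankK.
have /colP/(_ i) := pP; rewrite !mxE moni md eqxx /tau => eqtau.
transitivity (multinomial_prod C m * (t@_m / multinomial_prod C m)).
  by rewrite mulrC divfK //; apply/prodf_neq0 => j _; exact: multinomial_neq0.
congr (_ * _); rewrite -eqtau; apply: eq_bigr => s _; congr (_ * _).
by rewrite mxE moni md eqxx.
Qed.

End Basis.
End HankelOfScheme.

(** The multiplication matrices satisfy [A (m + m') = A m *m A m'], so that
    [q *m A (m + m') *m p] is the product of a row and a column of size [r]. *)
Lemma hankel_of_cactus_scheme (C : numClosedFieldType) (n d r : nat) (f : {mpoly C[n]}) :
  in_span_of_length (fun=> d) (tensor_power 1 f) r -> hankel_rep 'I_r d f.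
Proof.
move=> [I [idI [D0 hilbI] t_span]]; pose N0 := D0 ord0; pose e0 := maxn N0 d.
have hilb e : (N0 <= e)%N -> hilbert_value I (fun=> e) r.
  by move=> le_e; apply: hilbI => i; rewrite (ord1 i).
have [y reg_l] := ex_regular_linear_form idI hilb.
have le_e0 : (N0 <= e0)%N by rewrite leq_maxl.
have le_d : (d <= e0)%N by rewrite leq_maxr.
have [b [hb spanb]] := hilb e0 le_e0.
have b_indep : indep_family I (fun=> e0) b.
  split=> // c Ic; have [c0 [_ uniq]] := spanb 0 (@multihomog0 _ _ _ _).
  have eq0 : c0 = 0.
    apply: uniq; rewrite big1 ?subr0; first exact: subscheme_ideal0.
    by move=> s _; rewrite mxE scale0r.
  have eqNc : c0 = - c.
    apply: uniq; rewrite sub0r -sumrN; congr (I _) : Ic.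
    by apply: eq_bigr => s _; rewrite mxE scaleNr opprK.
  by rewrite -[c]opprK -eqNc eq0 oppr0.
pose nn := fun _ : 'I_1 => n.
have /choice[A AP] : forall m : 'X_{1..nvars nn}, exists M : 'M[C]_r,
    forall s, coords I y b (mdeg m) ('X_[m] * b s) (row s M).
  move=> m; have /choice[z zP] : forall s, exists z, coords I y b (mdeg m) ('X_[m] * b s) z.
    move=> s; apply: (ex_coords idI hilb reg_l le_e0 b_indep).
    exact: multihomog1M (multihomog1X (erefl _)) (hb s) _.
  by exists (\matrix_s z s) => s; rewrite rowK.
have [q qP] : exists q, coords I y b 0 (linear_form (n := nn) (i := ord0) y ^+ e0) q.
  apply: (ex_coords idI hilb reg_l le_e0 b_indep); exact: multihomog1_pow.
have [p pP] := ex_span_functional idI reg_l b_indep AP le_d qP t_span.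
pose mj (u : 'X_{1..n}) : 'X_{1..nvars nn} := mjoin (fun=> u).
have mjD u v : mj (u + v)%MM = (mj u + mj v)%MM by apply/mnmP => x; rewrite !mnmE.
have mjU j : mj U_(j)%MM = U_(mvar (n := nn) (i := ord0) j)%MM.
  by rewrite -[RHS]mblockK; congr mjoin; apply/funext => i; rewrite (ord1 i) mblock_mvar eqxx.
have AD := mult_matrixD idI reg_l b_indep AP.
exists (fun u => (q *m A (mj u) *m p) 0 0), (fun s u => (q *m A (mj u)) 0 s).
exists (fun s u => (A (mj u) *m p) s 0), y; split.
- by move=> u v; rewrite mjD AD mulmxA -mulmxA mxE.
- move=> u; rewrite -[in RHS](mulmx1 (A (mj u))).
  rewrite -(mult_matrix_norm idI reg_l b_indep AP) mulmx_sumr mulmx_sumr mulmx_suml summxE.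
  by apply: eq_bigr => j _; rewrite -!scalemxAr -scalemxAl [RHS]mxE mjD mjU AD.
move=> u ud; have := pP (mj u).
rewrite mcoeff_tensor_power big_ord1 mjoinK /multinomial_prod big_ord1 mjoinK.
by apply; rewrite -(multideg1 _ ord0) -mdeg_mblock mjoinK.
Qed.

(** * Tensor powers of a limit *)

(** Every form is in the span of a fat point. Setting the first variable to 1
    identifies degree [d] with the polynomials of degree at most [d] in the other
    variables; extended by 0 to larger degrees, the functional lives on the
    finite-dimensional quotient by the forms of degree [d.+1] in the other
    variables. *)
Lemma ex_hankel_rep (C : numClosedFieldType) (n d : nat) (f : {mpoly C[n.+1]}) :
  exists T : finType, hankel_rep T d f.
Proof.
pose drop (m : 'X_{1..n.+1}) := [multinom if i == ord0 then 0 else m i | i < n.+1]%N.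
pose fill m := [multinom if i == ord0 then d - mdeg (drop m) else m i | i < n.+1]%N.
pose L m : C := if (mdeg (drop m) <= d)%N then f@_(fill m) / multinomial C (fill m) else 0.
have L_drop m m' : drop m = drop m' -> L m = L m'.
  move=> eqd; rewrite /L eqd (_ : fill m = fill m') //; apply/mnmP => i.
  rewrite !mnmE eqd; case: ifP => // i0.
  by move/mnmP/(_ i): eqd; rewrite !mnmE i0.
have dropD m m' : drop (m + m')%MM = (drop m + drop m')%MM.
  by apply/mnmP => i; rewrite !mnmE; case: ifP.
have dropK m : drop (drop m) = drop m.
  by apply/mnmP => i; rewrite !mnmE; case: (i == ord0).
exists 'X_{1..n.+1 < d.+1}; exists L, (fun s m => (drop m == val s)%:R).
exists (fun s m' => L (val s + m')%MM).
exists (fun j => (j == ord0)%:R); split.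
- move=> m m'; have [le_md|lt_dm] := leqP (mdeg (drop m)) d; last first.
    rewrite big1 => [|s _].
      by rewrite /L ifN // dropD mdegD -ltnNge (leq_trans lt_dm) ?leq_addr.
    by case: eqP => [ms|]; rewrite ?mul0r //; have := bmdeg s; rewrite -ms ltnS leqNgt lt_dm.
  rewrite (bigD1 (BMultinom (le_md : mdeg (drop m) < d.+1)%N)) //= eqxx mul1r big1.
    by rewrite addr0; apply: L_drop; rewrite !dropD dropK.
  move=> s neq; case: eqP => [ms|]; rewrite ?mul0r //.
  by case/eqP: neq; apply: val_inj; rewrite /= -ms.
- move=> m; rewrite (bigD1 ord0) //= mul1r big1 ?addr0.
    apply: L_drop; apply/mnmP => i; rewrite !mnmE; case: ifP => // i0.
    by rewrite eq_sym i0 addn0.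
  by move=> j /negPf ->; rewrite mul0r.
move=> m md.
have mE : (m ord0 + mdeg (drop m) = d)%N.
  rewrite -md !mdegE !big_ord_recl mnmE eqxx add0n; congr (_ + _)%N.
  by apply: eq_bigr => i _; rewrite mnmE.
have le_d : (mdeg (drop m) <= d)%N by rewrite -mE leq_addl.
rewrite /L le_d (_ : fill m = m).
  by rewrite mulrC divfK // multinomial_neq0.
apply/mnmP => i; rewrite mnmE; case: eqP => // ->.
by rewrite -mE addnK.
Qed.

Lemma ex_spanning_rows (K : fieldType) (B : nat) (X : set 'rV[K]_B) :
  exists b (e : 'I_b -> 'rV[K]_B),
  [/\ (b <= B)%N, forall j, X (e j) & forall x, X x -> (x <= \matrix_j e j)%MS].
Proof.
pose Q b := exists e : 'I_b -> 'rV[K]_B, (forall j, X (e j)) /\ row_free (\matrix_j e j).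
have leQ b : Q b -> (b <= B)%N by move=> [e [_ /eqP <-]]; exact: rank_leq_col.
have Q0 : Q 0%N.
  by exists (fun=> 0); split=> [[]|] //; rewrite /row_free [X in \rank X]flatmx0 mxrank0.
have [b [e [Xe free]] nQ] := ex_largest Q0 leQ.
exists b, e; split=> // [|x Xx]; first by apply: leQ; exists e.
apply/negPn/negP => nx; apply: nQ.
exists (fun j : 'I_b.+1 => oapp e x (unlift ord0 j)); split=> [j|].
  by case: unliftP => [i|] _ //=.
apply: inj_row_free => c; rewrite mulmx_sum_row big_ord_recl rowK unlift_none /=.
rewrite (eq_bigr (fun i => c 0 (lift ord0 i) *: e i)); last by move=> i _; rewrite rowK liftK.
have sumE : \sum_i c 0 (lift ord0 i) *: e i = (\row_i c 0 (lift ord0 i)) *m \matrix_j e j.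
  by rewrite mulmx_sum_row; apply: eq_bigr => i _; rewrite rowK mxE.
have [c0|nz_c0] := eqVneq (c 0 ord0) 0.
  rewrite c0 scale0r add0r sumE => /(congr1 (mulmx^~ (pinvmx (\matrix_j e j)))).
  rewrite mul0mx /= -mulmxA (mulmxVp free) mulmx1 => /rowP h.
  apply/rowP => i; rewrite mxE; case: (unliftP ord0 i) => [j ->|-> //].
  by have := h j; rewrite !mxE.
rewrite sumE => /eqP; rewrite addr_eq0 => /eqP xE; case/negP: nx.
rewrite -[x](scalerK nz_c0) xE; apply: scalemx_sub.
by rewrite -mulNmx submxMl.
Qed.

Section PowerMonomials.
Context (C : numClosedFieldType) (n d k : nat).
Local Notation E := 'X_{1..n < d.+1}.
Local Notation Tau := {ffun E -> 'I_k.+1}.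
Local Notation nn := (fun _ : 'I_k => n).

(** All monomials with exponents at most [k] in the coefficients of [g]; those of
    total degree [k] are the coefficients of its [k]-th tensor power. Their
    number is polynomial in [k]. *)
Definition power_monomials (g : {mpoly C[n]}) : 'rV[C]_#|{: Tau}| :=
  \row_t \prod_(u : E) g@_u ^+ (enum_val t : Tau) u.

(** Blocks of [m] that are equal contribute the same coefficient of [g]; the
    exponent of [g@_u] counts the blocks equal to [u]. *)
Lemma mcoeff_tensor_power_monomials (m : 'X_{1..nvars nn}) :
  (forall i, multideg m i = d) -> exists t, forall g : {mpoly C[n]},
    (tensor_power k g)@_m = power_monomials g 0 t.
Proof.
move=> md; have ltm i : (mdeg (mblock m i) < d.+1)%N by rewrite mdeg_mblock md.
pose h i : E := BMultinom (ltm i).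
have lt_h u : (#|[set i | h i == u]%SET| < k.+1)%N.
  by rewrite ltnS -[leqRHS]card_ord max_card.
exists (enum_rank [ffun u => Ordinal (lt_h u)]) => g.
rewrite mcoeff_tensor_power mxE enum_rankK.
rewrite (partition_big h predT) //=; apply: eq_bigr => u _; rewrite ffunE /=.
rewrite (eq_bigr (fun=> g@_u)) => [|i /eqP <- //].
by rewrite prodr_const; congr (_ ^+ _); apply: eq_card => i; rewrite !inE.
Qed.

Lemma tensor_power_sum (J : finType) (g : J -> {mpoly C[n]}) (c : J -> C) f :
    f \is d.-homog -> (forall j, g j \is d.-homog) ->
    power_monomials f = \sum_j c j *: power_monomials (g j) ->
  tensor_power k f = \sum_j c j *: tensor_power k (g j).
Proof.
move=> hf hg fE; apply/mpolyP => m; rewrite raddf_sum /=.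
have [/forallP md|/forallP nd] := boolP [forall i, multideg m i == d].
  have [|t tP] := @mcoeff_tensor_power_monomials m; first by move=> i; apply/eqP.
  rewrite tP fE summxE; apply: eq_bigr => j _.
  by rewrite mxE mcoeffZ tP.
have nd' : ~ (forall i, multideg m i = d) by move=> h; apply: nd => i; rewrite h.
rewrite (multihomog_coeff (multihomog_tensor_power hf) nd') big1 // => j _.
by rewrite mcoeffZ (multihomog_coeff (multihomog_tensor_power (hg j)) nd') mulr0.
Qed.

End PowerMonomials.

Section Limits.
Local Open Scope classical_set_scope.

Lemma cvg_prodn (K : numFieldType) (T : Type) (F : set_system T) (FF : Filter F)
    (J : Type) (s : seq J) (x : J -> T -> K^o) (a : J -> K^o) :
    (forall j, x j t @[t --> F] --> a j) ->
  (\prod_(j <- s) x j t : K^o) @[t --> F] --> (\prod_(j <- s) a j : K^o).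
Proof.
move=> cvgx; elim: s => [|j s IH].
  by rewrite big_nil; under eq_cvg do rewrite big_nil; exact: cvg_cst.
rewrite big_cons; under eq_cvg do rewrite big_cons.
exact: cvgM (cvgx j) IH.
Qed.

Lemma cvg_sumn (K : numFieldType) (T : Type) (F : set_system T) (FF : Filter F)
    (J : Type) (s : seq J) (x : J -> T -> K^o) (a : J -> K^o) :
    (forall j, x j t @[t --> F] --> a j) ->
  (\sum_(j <- s) x j t : K^o) @[t --> F] --> (\sum_(j <- s) a j : K^o).
Proof.
move=> cvgx; elim: s => [|j s IH].
  by rewrite big_nil; under eq_cvg do rewrite big_nil; exact: cvg_cst.
rewrite big_cons; under eq_cvg do rewrite big_cons.
exact: cvgD (cvgx j) IH.
Qed.

Context (R : realType).
Local Notation C := R[i].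

Lemma cvg_power_monomials n d k (f_ : R -> {mpoly C[n]}) (f : {mpoly C[n]}) t :
    (forall m, ((f_ e)@_m : C^o) @[e --> 0^'+] --> (f@_m : C^o)) ->
  (power_monomials d k (f_ e) 0 t : C^o) @[e --> 0^'+] -->
    (power_monomials d k f 0 t : C^o).
Proof.
move=> cvgf; rewrite mxE; under eq_cvg do rewrite mxE.
have powE (a : C) N : a ^+ N = \prod_(i < N) a by rewrite prodr_const card_ord.
apply: cvg_prodn => u; rewrite powE; under eq_cvg do rewrite powE.
exact: cvg_prodn.
Qed.

(** A linear subspace is the zero set of finitely many linear equations; those
    that hold along the family hold in the limit. *)
Lemma limit_in_span n d k (X : set {mpoly C[n]}) (f_ : R -> {mpoly C[n]}) (f : {mpoly C[n]}) :
    f \is d.-homog -> (forall g, X g -> g \is d.-homog) -> (forall e, 0 < e -> X (f_ e)) ->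
    (forall m, ((f_ e)@_m : C^o) @[e --> 0^'+] --> (f@_m : C^o)) ->
  exists b (g : 'I_b -> {mpoly C[n]}) (c : 'I_b -> C),
  [/\ (b <= k.+1 ^ #|{: 'X_{1..n < d.+1}}|)%N, forall j, X (g j)
    & tensor_power k f = \sum_j c j *: tensor_power k (g j)].
Proof.
move=> hf hX Xf cvgf.
have [b [e [le_b Xe spane]]] := ex_spanning_rows (power_monomials d k @` X).
have /choice[g gP] : forall j, exists g, X g /\ power_monomials d k g = e j.
  by move=> j; have [g Xg <-] := Xe j; exists g.
suff /submxP[c fE] : (power_monomials d k f <= \matrix_j e j)%MS.
  exists b, g, (fun j => c 0 j); split=> [|j|]; last 2 first.
  - by have [] := gP j.
  - apply: tensor_power_sum hf _ _ => [j|]; first by apply: hX; have [] := gP j.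
    rewrite fE mulmx_sum_row; apply: eq_bigr => j _; rewrite rowK.
    by have [_ ->] := gP j.
  by apply: leq_trans le_b _; rewrite card_ffun card_ord.
rewrite submxE; apply/eqP/rowP => j; rewrite mxE [RHS]mxE.
set Q := cokermx _.
have cvgQ : (\sum_t power_monomials d k (f_ x) 0 t * Q t j : C^o) @[x --> 0^'+] -->
    (\sum_t power_monomials d k f 0 t * Q t j : C^o).
  apply: cvg_sumn => t; apply: cvgM; last exact: cvg_cst.
  exact: cvg_power_monomials.
apply: (norm_cvg_unique cvgQ); apply: cvg_near_cst.
near=> x.
have /spane : (power_monomials d k @` X) (power_monomials d k (f_ x)).
  by exists (f_ x) => //; apply: Xf; near: x; exact: nbhs_right_gt.
by rewrite submxE => /eqP/rowP/(_ j); rewrite mxE [in RHS]mxE.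
Unshelve. all: by end_near.
Qed.
End Limits.

(** * Limits of roots *)

Section Growth.
Context (R : realType).
Implicit Types x r : R.

Lemma bernoulli (h : R) (k : nat) : 0 <= h -> 1 + k%:R * h <= (1 + h) ^+ k.
Proof.
move=> h0; elim: k => [|k IH]; first by rewrite mul0r addr0 expr0.
rewrite exprS; apply: le_trans (ler_wpM2l _ IH); last by rewrite addr_ge0.
have : 0 <= k%:R * h * h by rewrite !mulr_ge0.
by rewrite -natr1; lra.
Qed.

(** The inequality of Bernoulli for the square root of [x], squared, gives
    quadratic growth of [x ^+ k]. *)
Lemma linear_le_exp x : 1 < x -> exists K, forall k, (K <= k)%N -> k.+1%:R <= x ^+ k.
Proof.
move=> x1; pose s := Num.sqrt x; have x0 : 0 <= x by rewrite ltW // (lt_trans ltr01).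
have s1 : 1 < s by rewrite -sqrtr1 ltr_sqrt // (lt_trans ltr01).
pose h := s - 1; have h0 : 0 < h by rewrite subr_gt0.
pose K := (Num.trunc (2 / h ^+ 2)).+1; exists K => k le_Kk.
have kh : 2 <= k%:R * h ^+ 2.
  rewrite -ler_pdivrMr ?exprn_gt0 //; apply: le_trans (ltW (truncnS_gt _)) _.
  by rewrite ler_nat.
have -> : x ^+ k = (s ^+ k) ^+ 2 by rewrite exprAC sqr_sqrtr.
have := bernoulli k (ltW h0); rewrite [in leRHS]/h [1 + (s - 1)]addrC subrK => bern.
have le_sk : k%:R * h <= s ^+ k by apply: le_trans bern; rewrite lerDr.
apply: (@le_trans _ _ ((k%:R * h) ^+ 2)); last first.
  by rewrite lerXn2r // nnegrE ?mulr_ge0 ?exprn_ge0 ?(ltW h0) ?sqrtr_ge0.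
rewrite exprMn expr2 -mulrA; apply: (@le_trans _ _ (k%:R * 2)).
  by rewrite -natrM ler_nat muln2 -addnn -addn1 leq_add2l (leq_trans _ le_Kk).
by rewrite ler_wpM2l.
Qed.

(** By induction, writing [x ^+ k] as the product of two powers of the square root
    of [x], one for [k.+1%:R ^+ N] and one for the additional factor. *)
Lemma poly_le_exp N x : 1 < x ->
  exists K, forall k, (K <= k)%N -> k.+1%:R ^+ N <= x ^+ k.
Proof.
elim: N x => [|N IH] x x1.
  by exists 0%N => k _; rewrite expr0 exprn_ege1 // ltW.
have x0 : 0 <= x by rewrite ltW // (lt_trans ltr01).
have s1 : 1 < Num.sqrt x by rewrite -sqrtr1 ltr_sqrt // (lt_trans ltr01).
have [K1 K1P] := IH _ s1; have [K2 K2P] := linear_le_exp s1.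
exists (maxn K1 K2) => k; rewrite geq_max => /andP[/K1P le1 /K2P le2].
have -> : x ^+ k = Num.sqrt x ^+ k * Num.sqrt x ^+ k by rewrite -exprMn -expr2 sqr_sqrtr.
by rewrite exprS; apply: ler_pM => //; rewrite exprn_ge0.
Qed.

Lemma poly_exp_le_exp N r x : 0 <= r -> r < x ->
  exists K, forall k, (K <= k)%N -> k.+1%:R ^+ N * r ^+ k <= x ^+ k.
Proof.
rewrite le_eqVlt => /predU1P[<- x0|r0 ltrx].
  by exists 1%N => k k0; rewrite expr0n eqn0Ngt k0 mulr0 exprn_ge0 // ltW.
have [|K KP] := @poly_le_exp N (x / r); first by rewrite ltr_pdivlMr ?mul1r.
exists K => k /KP; rewrite expr_div_n ler_pdivlMr // exprn_gt0 //.
Qed.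

(** If the limit [l] were above [r], then [a k] would eventually exceed [x ^+ k]
    for [x] halfway between [r] and [l]. A divergent sequence has the default
    limit 0. *)
Lemma limn_root_le N (r : R) (a : nat -> R) : 0 <= r ->
    (forall k, (0 < k)%N -> 0 <= a k <= k.+1%:R ^+ N * r ^+ k) ->
  limn (fun k => a k `^ k%:R^-1) <= r.
Proof.
move=> r0 le_a.
have [cvga|dvga] := pselect (cvgn (fun k => a k `^ k%:R^-1)); last by rewrite (dvgP dvga).
rewrite leNgt; apply/negP => ltr.
set l := limn _ in cvga ltr; pose x := (r + l) / 2.
have ltrx : r < x by rewrite midf_lt.
have ltxl : x < l by rewrite midf_lt.
have [K KP] := poly_exp_le_exp N r0 ltrx.
have [K' _ K'P] := cvgr_gt _ cvga _ ltxl.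
pose k := (maxn (maxn K K') 1).
have k0 : (0 < k)%N by rewrite leq_max orbT.
have K'k : (K' <= k)%N by rewrite !leq_max leqnn orbT.
have Kk : (K <= k)%N by rewrite !leq_max leqnn.
have /= ltxa := K'P k K'k; have /andP[a0 leak] := le_a k k0.
have x0 : 0 <= x by rewrite (le_trans r0) // ltW.
have : x ^+ k < (a k `^ k%:R^-1) ^+ k by rewrite ltrXn2r // -lt0n.
rewrite -[X in _ < X]powR_mulrn ?powR_ge0 // -powRrM mulVf ?pnatr_eq0 -?lt0n // powRr1 //.
by rewrite ltNge (le_trans leak) // KP.
Qed.
End Growth.

(** * The bound *)

Section Main.
Context (R : realType).
Local Notation C := R[i].

(** The projective space of the zero vector space is empty: saturation
    makes every saturated ideal the whole ring, so all schemes have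
    length 0. *)
Lemma cactus_rank_no_vars (k d : nat) (t : {mpoly C[nvars (fun _ : 'I_k => 0%N)]}) :
  (0 < k)%N -> cactus_rank (n := fun=> 0%N) (fun=> d) t = 0%N.
Proof.
case: k t => // k t _; apply: cactus_rank_eq0 => r [I [idI [D0 hilbI] _]].
have [b [_ spanb]] := hilbI D0 (fun _ => leqnn _).
have IT F : I F by apply: (subscheme_ideal_sat idI) => c; case: (c ord0).
have [c [_ uniq]] := spanb 0 (@multihomog0 _ _ _ _).
case: r {hilbI spanb} b c uniq => // r b c uniq.
have /rowP/(_ ord0) := etrans (esym (uniq (const_mx 1) (IT _))) (uniq 0 (IT _)).
by rewrite !mxE => /eqP; rewrite oner_eq0.
Qed.

(** By [ex_hankel_rep] some scheme spans [f], so the cactus rank is attained and not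
    a default value. *)
Lemma hankel_rep_of_form_rank n d (f : {mpoly C[n.+1]}) :
  f \is d.-homog -> hankel_rep 'I_(form_cactus_rank d f) d f.
Proof.
move=> hf; have [T hT] := ex_hankel_rep d f.
have [r _] := @cactus_scheme_of_hankel C 1 n.+1 d 'I_1 T
  (fun=> f) (fun=> 1) (fun=> hf) (fun=> hT).
rewrite big_ord1 scale1r => /cactus_rank_span.
exact: hankel_of_cactus_scheme.
Qed.

(** The constant family at [f] shows that the minimum is over a nonempty set. *)
Lemma border_cactus_rank_family n d (f : {mpoly C[n]}) : f \is d.-homog ->
  exists f_ : R -> {mpoly C[n]},
    (forall e : R, 0 < e -> f_ e \is d.-homog /\
       form_cactus_rank d (f_ e) = border_cactus_rank d f) /\
    forall m : 'X_{1..n}, (((f_ e)@_m : C^o) @[e --> 0^'+] --> (f@_m : C^o))%classic.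
Proof.
move=> hf; pose A : set nat := fun r => exists f_ : R -> {mpoly C[n]},
    (forall e : R, 0 < e -> f_ e \is d.-homog /\ form_cactus_rank d (f_ e) = r) /\
    forall m : 'X_{1..n}, (((f_ e)@_m : C^o) @[e --> 0^'+] --> (f@_m : C^o))%classic.
apply: (@least_mem A (form_cactus_rank d f)).
by exists (fun=> f); split=> // m; exact: cvg_cst.
Qed.

Lemma cactus_rank_tensor_power_le n d k (f : {mpoly C[n.+1]}) : f \is d.-homog ->
  (cactus_rank (fun=> d) (tensor_power k f) <=
    k.+1 ^ #|{: 'X_{1..n.+1 < d.+1}}| * border_cactus_rank d f ^ k)%N.
Proof.
move=> hf; have [f_ [f_P cvgf]] := border_cactus_rank_family hf.
set r := border_cactus_rank d f in f_P *.
pose X : set {mpoly C[n.+1]} := [set g | g \is d.-homog /\ hankel_rep 'I_r d g]%classic.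
have [g [/= hg _]|e e0|b [g [c [le_b Xg ->]]]] := @limit_in_span R n.+1 d k X f_ f hf _ _ cvgf.
- by [].
- have [hfe rankE] := f_P e e0; split=> //.
  by have := hankel_rep_of_form_rank hfe; rewrite rankE.
have [s le_s Ss] := @cactus_scheme_of_hankel C k n.+1 d 'I_b 'I_r g c
  (fun j => (Xg j).1) (fun j => (Xg j).2).
apply: leq_trans (cactus_rank_le Ss) _; apply: leq_trans le_s _.
by rewrite !card_ord leq_mul2r le_b orbT.
Qed.

End Main.

Theorem proposition2p8 (R : realType) (n d : nat) (f : {mpoly R[i][n]})
    (f_homog : f \is d.-homog) (f_neq0 : f != 0) :
  tensor_asymptotic_cactus_rank d f <= (border_cactus_rank d f)%:R.
Proof.
case: n f f_homog f_neq0 => [|n] f hf _; rewrite /tensor_asymptotic_cactus_rank.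
  (* no variables: the cactus ranks of the tensor powers are all 0 *)
  apply: (@limn_root_le _ 0) => // k k0.
  by rewrite (cactus_rank_no_vars _ _ k0) lexx mul1r exprn_ge0.
apply: (@limn_root_le _ #|{: 'X_{1..n.+1 < d.+1}}|) => // k _.
by rewrite ler0n -!natrX -natrM ler_nat cactus_rank_tensor_power_le.
Qed.
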